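(* Let $\gamma$ be an oval with outer length billiard map $F$, and fix an origin $O$ in the interior of $\gamma$. For every positive integer $k$ there is a constant $\rho=\rho(k,\gamma)$ such that every point $z$ in the exterior of $\gamma$ with $F^k(z)=z$ satisfies $|z|\le\rho$. That is, $F$ has no $k$-periodic orbits outside the disc of radius $\rho$ centered at $O$.
   Context: An oval is a smooth closed simple planar curve $\gamma$ with everywhere positive curvature; it bounds a compact strictly convex domain $K$. Orient $\gamma$ counterclockwise. For a point $A\in\mathbb{R}^2\setminus K$ there are exactly two lines through $A$ tangent to $\gamma$. The positive tangency point $x_+(A)$ is the one for which $x_+(A)-A$ is a positive multiple of the oriented tangent vector of $\gamma$ at $x_+(A)$. The negative tangency point $x_-(A)$ is the one for which $A-x_-(A)$ is a positive multiple of the oriented tangent vector of $\gamma$ at $x_-(A)$. Outer length billiard map $F:\mathbb{R}^2\setminus K\to\mathbb{R}^2\setminus K$. Let $\Sigma_A$ be the circle that is inscribed in the angle with vertex $A$ formed by the ray from $A$ through $x_+(A)$ and the ray from $A$ opposite to the ray from $A$ through $x_-(A)$, and that touches the first ray at $x_+(A)$. Then $\Sigma_A$ and $\gamma$ touch externally at $x_+(A)$. They have exactly three common tangent lines, two of which are the lines $Ax_+(A)$ and $Ax_-(A)$. $F(A)$ is the intersection point of the third common tangent line with the line $Ax_+(A)$. *)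

(* Defs.v *)
From Stdlib Require Import Reals ClassicalEpsilon.
From Coquelicot Require Import Coquelicot.
Open Scope R_scope.

Definition pt : Type := (R * R)%type.
Definition vadd (u v : pt) : pt := (fst u + fst v, snd u + snd v).
Definition vsub (u v : pt) : pt := (fst u - fst v, snd u - snd v).
Definition vscale (a : R) (u : pt) : pt := (a * fst u, a * snd u).
Definition dot (u v : pt) : R := fst u * fst v + snd u * snd v.
Definition cross (u v : pt) : R := fst u * snd v - snd u * fst v.
Definition vnorm (u : pt) : R := sqrt (dot u u).

Definition curve (x y : R -> R) (t : R) : pt := (x t, y t).
Definition tangent (x y : R -> R) (t : R) : pt := (Derive x t, Derive y t).

(* gamma is an oval: an L-periodic, C^oo, simple (injective on [0,L)) closed
   curve with everywhere positive signed curvature x'y''-y'x'' > 0, i.e. the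
   parametrization is counterclockwise and the curvature is positive. *)
Definition is_oval (x y : R -> R) (L : R) : Prop :=
  0 < L /\
  (forall t, x (t + L) = x t /\ y (t + L) = y t) /\
  (forall (n : nat) (t : R), ex_derive (Derive_n x n) t /\ ex_derive (Derive_n y n) t) /\
  (forall s t, 0 <= s < L -> 0 <= t < L -> curve x y s = curve x y t -> s = t) /\
  (forall t, Derive x t * Derive_n y 2 t - Derive y t * Derive_n x 2 t > 0).

(* The compact convex domain K bounded by the (counterclockwise) oval:
   the intersection of the closed half-planes to the left of the tangent lines. *)
Definition in_K (x y : R -> R) (A : pt) : Prop :=
  forall t, 0 <= cross (tangent x y t) (vsub A (curve x y t)).

Definition in_interior_K (x y : R -> R) (A : pt) : Prop :=
  forall t, 0 < cross (tangent x y t) (vsub A (curve x y t)).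

Definition exterior (x y : R -> R) (A : pt) : Prop := ~ in_K x y A.

(* The line through P with direction d differs from the line through Q with
   direction v (d, v nonzero). *)
Definition distinct_lines (P d Q v : pt) : Prop :=
  cross d v <> 0 \/ cross v (vsub P Q) <> 0.

Definition is_F (x y : R -> R) (A B : pt) : Prop :=
  exterior x y A /\
  exists tp tm lp lm : R,
    0 < lp /\ 0 < lm /\
    (* x_+(A) = curve tp : x_+ - A positive multiple of the tangent at x_+ *)
    vsub (curve x y tp) A = vscale lp (tangent x y tp) /\
    (* x_-(A) = curve tm : A - x_- positive multiple of the tangent at x_- *)
    vsub A (curve x y tm) = vscale lm (tangent x y tm) /\
    let P := curve x y tp in
    let M := curve x y tm in
    let u := vsub P A in
    let w := vsub A M in   (* direction of the ray opposite to the ray A x_- *)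
    (* the circle Sigma_A with center c and radius r *)
    exists (c : pt) (r : R),
      0 < r /\
      (* center lies inside the angle spanned by the two rays *)
      (exists a b : R, 0 < a /\ 0 < b /\ c = vadd A (vadd (vscale a u) (vscale b w))) /\
      (* touches the first ray at x_+ *)
      dot (vsub c P) u = 0 /\ vnorm (vsub c P) = r /\
      (* tangent to the second side of the angle *)
      Rabs (cross w (vsub c A)) = r * vnorm w /\
      (* third common tangent line of Sigma_A and gamma: tangent line to gamma
         at curve s, tangent to Sigma_A, distinct from lines A x_+ and A x_- *)
      exists s : R,
        Rabs (cross (tangent x y s) (vsub c (curve x y s))) = r * vnorm (tangent x y s) /\
        distinct_lines (curve x y s) (tangent x y s) A u /\
        distinct_lines (curve x y s) (tangent x y s) A w /\
        (* B is its intersection with the line A x_+ *)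
        exists beta : R,
          B = vadd A (vscale beta u) /\
          cross (tangent x y s) (vsub B (curve x y s)) = 0.

Definition F (x y : R -> R) (A : pt) : pt :=
  epsilon (inhabits A) (fun B => is_F x y A B).

(* Main.v *)
(* Take [O] as origin. The line from [A] to [F A] is tangent to the curve and leaves
   [O] strictly on its left, so [cross A (F A) > 0]: the direction advances by an angle
   less than [PI]. When [A] is far away, at distance [l] from the tangency point, the
   circle has radius of order [l ^ 2] and the third tangent meets the line on the other
   side of the tangency point, at a distance of order at least [l]; so the advance is
   close to [PI] and [F A] is again far away. After [k] steps the total advance lies
   strictly between [(k - 1) * PI] and [k * PI], which excludes [F ^ k A = A].
   Global convexity of the oval comes from the interior point: the curve is
   star-shaped about [O], simplicity makes its polar angle turn exactly once, and the
   tangent angle, which stays within [(0, PI)] of the polar angle, turns exactly once too. *)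
Require Import Defs.
From Stdlib Require Import Reals Lra Lia ZArith ClassicalEpsilon.
From Coquelicot Require Import Coquelicot.
Open Scope R_scope.

(** * Angle functions *)

(** [F] chooses some point satisfying the relation [is_F]. So for far points two things are
    established: some image exists, and the estimates hold for every image that the relation admits.
    The relation asks only for a tangent of both curves distinct from the two given lines; inner
    common tangents, and outer ones that cross the line on the side of [A], must be excluded by
    inequalities. All bounds are explicit in two numbers: [h > 0], below the support function about
    [O], and [C], above the distance from [O] to the curve. Angle functions serve to obtain
    convexity and to locate tangency points. The billiard estimates use only [cross] and [dot]; the
    advance along an orbit is measured by its small defect from [PI] at each step, whose tangent is
    easy to bound under addition. *)

Lemma IVT_sign (f : R -> R) (a b : R) :
  (forall t, continuous f t) -> a < b -> f a * f b < 0 ->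
  exists t, a < t < b /\ f t = 0.
Proof.
  intros Hc Hab Hs.
  destruct (IVT_gen f a b 0) as [t [Ht Hft]].
  - intros t; apply continuity_pt_filterlim, Hc.
  - destruct (Rle_dec (f a) (f b)) as [H|H].
    + rewrite Rmin_left, Rmax_right by lra. nra.
    + rewrite Rmin_right, Rmax_left by lra. nra.
  - rewrite Rmin_left, Rmax_right in Ht by lra.
    exists t; split; [|exact Hft].
    split; apply Rnot_le_lt; intros Hle.
    + replace t with a in Hft by lra. nra.
    + replace t with b in Hft by lra. nra.
Qed.

Lemma nonvanishing_pos (f : R -> R) (a : R) :
  (forall t, continuous f t) -> (forall t, f t <> 0) -> 0 < f a ->
  forall t, 0 < f t.
Proof.
  intros Hc Hz Ha t.
  destruct (Rtotal_order (f t) 0) as [H|[H|H]]; [|now apply Hz in H|exact H].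
  exfalso.
  destruct (Rtotal_order a t) as [Hat|[Hat|Hat]]; [|subst; lra|].
  - destruct (IVT_sign f a t Hc Hat) as [z [_ Hz0]]; [nra|now apply (Hz z)].
  - destruct (IVT_sign f t a Hc Hat) as [z [_ Hz0]]; [nra|now apply (Hz z)].
Qed.

Lemma is_derive_continuous (f : R -> R) (t l : R) : is_derive f t l -> continuous f t.
Proof. intros H; apply (ex_derive_continuous (K := R_AbsRing) (V := R_NormedModule)); now exists l. Qed.

Lemma derive_zero_const (f : R -> R) :
  (forall t, is_derive f t 0) -> forall a b, f a = f b.
Proof.
  intros Hf a b.
  destruct (MVT_gen f a b (fun _ => 0)) as [z [_ Hz]].
  - intros t _; apply Hf.
  - intros t _; apply continuity_pt_filterlim, (is_derive_continuous f t 0), Hf.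
  - lra.
Qed.

Lemma cos_one_ge_2PI (c : R) : 0 < c -> cos c = 1 -> 2 * PI <= c.
Proof.
  intros Hc H1. apply Rnot_lt_le; intros Hlt.
  assert (Hs : 0 < sin (c / 2)) by (apply sin_gt_0; lra).
  replace c with (2 * (c / 2)) in H1 by field.
  rewrite cos_2a_sin in H1. nra.
Qed.

Lemma unit_vector_angle (a b : R) :
  a * a + b * b = 1 -> exists t, a = cos t /\ b = sin t.
Proof.
  intros H.
  assert (Ha : -1 <= a <= 1) by nra.
  assert (Hb : sqrt (1 - a * a) = Rabs b).
  { replace (1 - a * a) with (Rsqr b) by (unfold Rsqr; lra). apply sqrt_Rsqr_abs. }
  destruct (Rle_dec 0 b) as [H0|H0].
  - exists (acos a). rewrite cos_acos, sin_acos by assumption.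
    unfold Rsqr. rewrite Hb, Rabs_right by lra. now split.
  - exists (- acos a). rewrite cos_neg, sin_neg, cos_acos, sin_acos by assumption.
    unfold Rsqr. rewrite Hb, Rabs_left by lra. split; lra.
Qed.

Definition dir (a : R) : pt := (cos a, sin a).

Lemma polar_form (v : pt) : exists a, v = vscale (vnorm v) (dir a).
Proof.
  destruct v as [a b]. unfold vscale, vnorm, dot, dir; simpl.
  destruct (Req_dec (a * a + b * b) 0) as [H|H].
  - exists 0. rewrite H, sqrt_0. assert (a = 0) by nra. assert (b = 0) by nra.
    subst. f_equal; ring.
  - set (n := sqrt (a * a + b * b)).
    assert (Hn : 0 < n) by (apply sqrt_lt_R0; nra).
    assert (Hnn : n * n = a * a + b * b) by (apply sqrt_sqrt; nra).
    destruct (unit_vector_angle (a / n) (b / n)) as [t [Hc Hs]].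
    { field_simplify; [|lra]. apply Rmult_eq_reg_r with (n ^ 2); [|nra].
      field_simplify; [|lra]. nra. }
    exists t. rewrite <- Hc, <- Hs. f_equal; field; lra.
Qed.

(* With [z = X + iY] and [theta' = Im (z' / z)], both coordinates of
   [z * exp (- i theta)] satisfy [w' = Re (z' / z) * w], as does [|z|]; hence the
   imaginary part, which vanishes at 0, vanishes identically. *)
Lemma angle_lift (X Y X' Y' : R -> R) :
  (forall t, is_derive X t (X' t)) -> (forall t, is_derive Y t (Y' t)) ->
  (forall t, continuous X' t) -> (forall t, continuous Y' t) ->
  (forall t, 0 < X t * X t + Y t * Y t) ->
  exists th : R -> R,
    (forall t, is_derive th t ((X t * Y' t - Y t * X' t) / (X t * X t + Y t * Y t))) /\
    (forall t, (X t, Y t) = vscale (vnorm (X t, Y t)) (dir (th t))).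
Proof.
  intros HX HY HX' HY' Hpos.
  assert (cX : forall t, continuous X t) by (intros t; eapply is_derive_continuous, HX).
  assert (cY : forall t, continuous Y t) by (intros t; eapply is_derive_continuous, HY).
  set (w := fun t => (X t * Y' t - Y t * X' t) / (X t * X t + Y t * Y t)).
  assert (cw : forall t, continuous w t).
  { intros t; unfold w, Rdiv.
    apply (continuous_mult (K := R_AbsRing)).
    - apply (continuous_minus (V := R_NormedModule));
        apply (continuous_mult (K := R_AbsRing)); auto.
    - apply continuous_comp with (g := Rinv).
      + apply (continuous_plus (V := R_NormedModule));
          apply (continuous_mult (K := R_AbsRing)); auto.
      + apply continuous_Rinv. specialize (Hpos t). lra. }
  (* The prescribed derivative fixes [th] up to a constant, which the direction at 0 determines. *)
  destruct (polar_form (X 0, Y 0)) as [a0 Ha0].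
  set (th := fun t => a0 + RInt w 0 t).
  assert (Hth : forall t, is_derive th t (w t)).
  { intros t. unfold th. replace (w t) with (0 + w t) by ring.
    apply (is_derive_plus (V := R_NormedModule) (fun _ => a0) (fun t => RInt w 0 t)).
    - apply (is_derive_const (V := R_NormedModule)).
    - apply (is_derive_RInt (V := R_NormedModule) w (fun t => RInt w 0 t) 0).
      + apply filter_forall; intros b. apply (RInt_correct (V := R_CompleteNormedModule)).
        apply (ex_RInt_continuous (V := R_CompleteNormedModule)); auto.
      + apply cw. }
  exists th; split; [exact Hth|].
  set (U := fun t => X t * cos (th t) + Y t * sin (th t)).
  set (V := fun t => Y t * cos (th t) - X t * sin (th t)).
  assert (HU : forall t, is_derive U t
     (X' t * cos (th t) - X t * (w t * sin (th t)) + (Y' t * sin (th t) + Y t * (w t * cos (th t))))).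
  { intros t; unfold U. specialize (HX t); specialize (HY t); specialize (Hth t).
    auto_derive.
    - repeat split; eexists; eassumption.
    - apply is_derive_unique in HX; apply is_derive_unique in HY; apply is_derive_unique in Hth.
      change (Derive (fun x : R => X x) t) with (Derive X t).
      change (Derive (fun x : R => Y x) t) with (Derive Y t).
      change (Derive (fun x : R => th x) t) with (Derive th t).
      rewrite HX, HY, Hth. ring. }
  assert (HV : forall t, is_derive V t
     (Y' t * cos (th t) - Y t * (w t * sin (th t)) - (X' t * sin (th t) + X t * (w t * cos (th t))))).
  { intros t; unfold V. specialize (HX t); specialize (HY t); specialize (Hth t).
    auto_derive.
    - repeat split; eexists; eassumption.
    - apply is_derive_unique in HX; apply is_derive_unique in HY; apply is_derive_unique in Hth.
      change (Derive (fun x : R => X x) t) with (Derive X t).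
      change (Derive (fun x : R => Y x) t) with (Derive Y t).
      change (Derive (fun x : R => th x) t) with (Derive th t).
      rewrite HX, HY, Hth. ring. }
  assert (HN : forall t, U t * U t + V t * V t = X t * X t + Y t * Y t).
  { intros t; unfold U, V. pose proof (sin2_cos2 (th t)) as E; unfold Rsqr in E.
    transitivity ((X t * X t + Y t * Y t) * (sin (th t) * sin (th t) + cos (th t) * cos (th t))); [ring|].
    rewrite E; ring. }
  (* Squaring avoids differentiating the norm: it is the square of the ratio of [V] to the norm that
     is shown constant. *)
  assert (Hcst : forall t, is_derive (fun t => V t * V t / (X t * X t + Y t * Y t)) t 0).
  { intros t. pose proof (HV t) as HVt; pose proof (HX t) as HXt; pose proof (HY t) as HYt.
    pose proof (Hpos t) as Hp.
    auto_derive.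
    - repeat split; try (eexists; eassumption). lra.
    - apply is_derive_unique in HXt; apply is_derive_unique in HYt; apply is_derive_unique in HVt.
      change (Derive (fun x : R => X x) t) with (Derive X t).
      change (Derive (fun x : R => Y x) t) with (Derive Y t).
      change (Derive (fun x : R => V x) t) with (Derive V t).
      rewrite HXt, HYt, HVt.
      assert (HVk : Y' t * cos (th t) - Y t * (w t * sin (th t)) - (X' t * sin (th t) + X t * (w t * cos (th t)))
         = (X t * X' t + Y t * Y' t) / (X t * X t + Y t * Y t) * V t).
      { unfold w, V. field. lra. }
      rewrite HVk. field. lra. }
  assert (E0 : sqrt (X 0 * X 0 + Y 0 * Y 0) > 0) by (apply sqrt_lt_R0, Hpos).
  assert (Hth0 : th 0 = a0).
  { unfold th. rewrite RInt_point. unfold zero; simpl. ring. }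
  assert (HX0 : X 0 = sqrt (X 0 * X 0 + Y 0 * Y 0) * cos a0) by exact (f_equal fst Ha0).
  assert (HY0 : Y 0 = sqrt (X 0 * X 0 + Y 0 * Y 0) * sin a0) by exact (f_equal snd Ha0).
  assert (HV0 : V 0 = 0).
  { unfold V. rewrite Hth0. set (n := sqrt _) in *. rewrite HX0, HY0; ring. }
  assert (HVz : forall t, V t = 0).
  { intros t. pose proof (derive_zero_const _ Hcst t 0) as E. cbv beta in E.
    rewrite HV0 in E. pose proof (Hpos t) as Hp.
    assert (E1 : V t * V t = (V t * V t / (X t * X t + Y t * Y t)) * (X t * X t + Y t * Y t)) by (field; lra).
    rewrite E in E1. unfold Rdiv in E1. nra. }
  (* Since [V = 0], [U] is plus or minus the norm; it has no zero and is positive at 0, so the sign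
     is plus. *)
  assert (HUpos : forall t, 0 < U t).
  { apply (nonvanishing_pos U 0).
    - intros t; eapply is_derive_continuous, HU.
    - intros t Hz. specialize (HN t). rewrite Hz, HVz in HN. specialize (Hpos t). lra.
    - unfold U. rewrite Hth0. set (n := sqrt _) in *. rewrite HX0, HY0.
      pose proof (sin2_cos2 a0) as E; unfold Rsqr in E. nra. }
  intros t. unfold vscale, vnorm, dot, dir; simpl.
  assert (Hn : sqrt (X t * X t + Y t * Y t) = U t).
  { rewrite <- HN, HVz. replace (U t * U t + 0 * 0) with (Rsqr (U t)) by (unfold Rsqr; ring).
    apply sqrt_Rsqr. left; apply HUpos. }
  rewrite Hn. pose proof (HVz t) as Hv. pose proof (sin2_cos2 (th t)) as E; unfold Rsqr in E.
  unfold V in Hv. unfold U. f_equal.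
  - transitivity (X t * (sin (th t) * sin (th t) + cos (th t) * cos (th t))); [rewrite E; ring|].
    replace (X t * (sin (th t) * sin (th t) + cos (th t) * cos (th t))) with
     ((X t * cos (th t) + Y t * sin (th t)) * cos (th t) - (Y t * cos (th t) - X t * sin (th t)) * sin (th t)) by ring.
    rewrite Hv; ring.
  - transitivity (Y t * (sin (th t) * sin (th t) + cos (th t) * cos (th t))); [rewrite E; ring|].
    replace (Y t * (sin (th t) * sin (th t) + cos (th t) * cos (th t))) with
     ((X t * cos (th t) + Y t * sin (th t)) * sin (th t) + (Y t * cos (th t) - X t * sin (th t)) * cos (th t)) by ring.
    rewrite Hv; ring.
Qed.

(** * Monotone, periodic and quasi-periodic functions *)

Lemma is_derive_increasing (f f' : R -> R) :
  (forall t, is_derive f t (f' t)) -> (forall t, 0 < f' t) ->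
  forall s t, s < t -> f s < f t.
Proof.
  intros Hf Hp s t Hst.
  destruct (MVT_gen f s t f') as [z [_ Hz]].
  - intros; apply Hf.
  - intros; eapply continuity_pt_filterlim, is_derive_continuous, Hf.
  - specialize (Hp z). nra.
Qed.

Lemma shift_nat (f : R -> R) (L c : R) :
  (forall t, f (t + L) = f t + c) -> forall (n : nat) t, f (t + INR n * L) = f t + INR n * c.
Proof.
  intros Hf n; induction n as [|n IH]; intros t.
  - simpl. replace (t + 0 * L) with t by ring. ring.
  - rewrite S_INR. replace (t + (INR n + 1) * L) with (t + INR n * L + L) by ring.
    rewrite Hf, IH. ring.
Qed.

Lemma periodic_nat {T : Type} (f : R -> T) (L : R) :
  (forall t, f (t + L) = f t) -> forall (n : nat) t, f (t + INR n * L) = f t.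
Proof.
  intros Hf n; induction n as [|n IH]; intros t.
  - simpl. f_equal; ring.
  - rewrite S_INR. replace (t + (INR n + 1) * L) with (t + INR n * L + L) by ring.
    now rewrite Hf, IH.
Qed.

Lemma periodic_Z {T : Type} (f : R -> T) (L : R) :
  (forall t, f (t + L) = f t) -> forall (k : Z) t, f (t + IZR k * L) = f t.
Proof.
  intros Hf k t. destruct (Z.le_gt_cases 0 k) as [Hk|Hk].
  - rewrite <- (Z2Nat.id k Hk), <- INR_IZR_INZ. now apply periodic_nat.
  - set (n := Z.to_nat (- k)).
    assert (E : IZR k = - INR n).
    { unfold n. rewrite INR_IZR_INZ, Z2Nat.id, opp_IZR by lia. ring. }
    rewrite <- (periodic_nat f L Hf n (t + IZR k * L)). f_equal. rewrite E; ring.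
Qed.

Lemma period_representative (L a t : R) :
  0 < L -> exists k : Z, a <= t + IZR k * L < a + L.
Proof.
  intros HL. exists (- (up ((t - a) / L) - 1))%Z.
  rewrite opp_IZR, minus_IZR.
  destruct (archimed ((t - a) / L)) as [H1 H2].
  set (n := IZR (up ((t - a) / L))) in *.
  assert (E : t - a = (t - a) / L * L) by (field; lra).
  set (q := (t - a) / L) in *. nra.
Qed.

(** A shift by whole periods puts [s] in [[0, L)]. Then [t] falls in the same period or in the next
    one, and one further shift by [L] settles the second case. *)
Lemma simple_injective {T : Type} (f : R -> T) (L : R) :
  0 < L -> (forall t, f (t + L) = f t) ->
  (forall s t, 0 <= s < L -> 0 <= t < L -> f s = f t -> s = t) ->
  forall s t, s < t < s + L -> f s <> f t.
Proof.
  intros HL Hper Hinj s t Hst Heq.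
  destruct (period_representative L 0 s HL) as [k Hk].
  destruct (Rlt_dec (t + IZR k * L) L) as [H|H].
  - assert (s + IZR k * L = t + IZR k * L); [|lra].
    apply Hinj; [lra|lra|]. now rewrite !(periodic_Z f L Hper).
  - assert (s + IZR k * L = t + IZR (k - 1) * L).
    + apply Hinj; [lra|rewrite minus_IZR; lra|]. now rewrite !(periodic_Z f L Hper).
    + rewrite minus_IZR in *; lra.
Qed.

Lemma quasiperiodic_surjective (f : R -> R) (L c : R) :
  0 < L -> 0 < c -> (forall t, continuous f t) -> (forall t, f (t + L) = f t + c) ->
  forall a, exists t, f t = a.
Proof.
  intros HL Hc Hcont Hf a.
  (* [n] is so large that [n * c] exceeds the distance from [f 0] to [a]; the values of [f] at plus
     and minus [n * L] then bracket [a]. *)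
  destruct (archimed_cor1 (c / (Rabs (a - f 0) + 1))) as [n [Hn Hn0]].
  { apply Rdiv_lt_0_compat; [lra|]. pose proof (Rabs_pos (a - f 0)); lra. }
  assert (Hnp : 0 < INR n) by (apply lt_0_INR; lia).
  pose proof (Rabs_pos (a - f 0)) as Hab.
  assert (Hbig : Rabs (a - f 0) < INR n * c).
  { apply (Rmult_lt_compat_r (INR n * (Rabs (a - f 0) + 1))) in Hn; [|nra].
    field_simplify in Hn; [|lra|lra]. lra. }
  pose proof (shift_nat f L c Hf n 0) as E1. rewrite Rplus_0_l in E1.
  pose proof (shift_nat f L c Hf n (- (INR n * L))) as E2.
  replace (- (INR n * L) + INR n * L) with 0 in E2 by ring.
  assert (Hlo : a - f 0 <= Rabs (a - f 0)) by apply Rle_abs.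
  assert (Hhi : - (a - f 0) <= Rabs (a - f 0)) by (rewrite <- Rabs_Ropp; apply Rle_abs).
  destruct (IVT_sign (fun t => f t - a) (- (INR n * L)) (INR n * L)) as [t [_ Ht]].
  - intros t; apply (continuous_minus (V := R_NormedModule)); [apply Hcont|apply continuous_const].
  - nra.
  - rewrite E1. replace (f (- (INR n * L))) with (f 0 - INR n * c) by lra. nra.
  - exists t; lra.
Qed.

Lemma increasing_inverse (f : R -> R) :
  (forall s t, s < t -> f s < f t) -> (forall a, exists t, f t = a) ->
  exists g : R -> R,
    (forall a, f (g a) = a) /\ (forall t, g (f t) = t) /\ (forall a, continuous g a).
Proof.
  intros Hinc Hsurj.
  assert (Hrefl : forall s t, f s < f t -> s < t).
  { intros s t H. destruct (Rtotal_order s t) as [E|[E|E]]; [exact E|subst; lra|].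
    apply Hinc in E; lra. }
  set (g := fun a => proj1_sig (constructive_indefinite_description _ (Hsurj a))).
  assert (Hg : forall a, f (g a) = a).
  { intros a; unfold g; now destruct (constructive_indefinite_description _ (Hsurj a)). }
  exists g; split; [exact Hg|split].
  - intros t. destruct (Rtotal_order (g (f t)) t) as [E|[E|E]]; [|exact E|];
      apply Hinc in E; rewrite Hg in E; lra.
  - intros a. apply continuity_pt_filterlim.
    intros eps Heps.
    assert (H1 : f (g a - eps) < a) by (rewrite <- (Hg a) at 2; apply Hinc; lra).
    assert (H2 : a < f (g a + eps)) by (rewrite <- (Hg a) at 1; apply Hinc; lra).
    exists (Rmin (a - f (g a - eps)) (f (g a + eps) - a)); split.
    { apply Rmin_pos; lra. }
    intros b [_ Hb]. simpl in *. unfold R_dist in *.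
    apply Rabs_lt_between in Hb.
    pose proof (Rmin_l (a - f (g a - eps)) (f (g a + eps) - a)).
    pose proof (Rmin_r (a - f (g a - eps)) (f (g a + eps) - a)).
    assert (g a - eps < g b) by (apply Hrefl; rewrite Hg; lra).
    assert (g b < g a + eps) by (apply Hrefl; rewrite Hg; lra).
    apply Rabs_lt_between; lra.
Qed.

Lemma periodic_bounded_below (f : R -> R) (L : R) :
  0 < L -> (forall t, continuous f t) -> (forall t, f (t + L) = f t) ->
  exists t0, forall t, f t0 <= f t.
Proof.
  intros HL Hc Hper.
  destruct (continuity_ab_min f 0 L) as [t0 [Hm _]]; [lra|intros; apply continuity_pt_filterlim, Hc|].
  exists t0; intros t. destruct (period_representative L 0 t HL) as [k Hk].
  rewrite <- (periodic_Z f L Hper k t). apply Hm; lra.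
Qed.

Lemma is_derive_periodic (f f' : R -> R) (L : R) :
  (forall t, is_derive f t (f' t)) -> (forall t, f (t + L) = f t) ->
  forall t, f' (t + L) = f' t.
Proof.
  intros Hf Hper t.
  rewrite <- (is_derive_unique _ _ _ (Hf t)). symmetry; apply is_derive_unique.
  apply is_derive_ext with (fun t => f (t + L)); [exact Hper|].
  pose proof (Hf (t + L)) as H.
  auto_derive; [eexists; eassumption|].
  change (Derive (fun x : R => f x) (t + L)) with (Derive f (t + L)).
  rewrite (is_derive_unique _ _ _ H); ring.
Qed.

(** [th (t + L)] and [th t] have the same derivative, so they differ by a constant; they give the
    same direction, so the constant is a multiple of [2 * PI]. It is recorded as [cos c = 1], which
    avoids integers. *)
Lemma angle_lift_period (X Y X' Y' th : R -> R) (L : R) :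
  (forall t, is_derive X t (X' t)) -> (forall t, is_derive Y t (Y' t)) ->
  (forall t, 0 < X t * X t + Y t * Y t) ->
  (forall t, X (t + L) = X t) -> (forall t, Y (t + L) = Y t) ->
  (forall t, is_derive th t ((X t * Y' t - Y t * X' t) / (X t * X t + Y t * Y t))) ->
  (forall t, (X t, Y t) = vscale (vnorm (X t, Y t)) (dir (th t))) ->
  exists c, cos c = 1 /\ forall t, th (t + L) = th t + c.
Proof.
  intros HX HY Hpos PX PY Hth Hpol.
  exists (th L - th 0); split.
  - pose proof (Hpol 0) as E0. pose proof (Hpol L) as E1.
    pose proof (PX 0) as PX0; pose proof (PY 0) as PY0. rewrite Rplus_0_l in PX0, PY0.
    rewrite PX0, PY0 in E1. unfold vscale, vnorm, dot, dir in E0, E1; simpl in E0, E1.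
    assert (Hn : 0 < sqrt (X 0 * X 0 + Y 0 * Y 0)) by apply sqrt_lt_R0, Hpos.
    set (n := sqrt _) in *. rewrite E0 in E1 at 1. injection E1 as Ec Es.
    apply Rmult_eq_reg_l in Ec; [|lra]. apply Rmult_eq_reg_l in Es; [|lra].
    rewrite cos_minus, <- Ec, <- Es.
    pose proof (sin2_cos2 (th 0)) as E; unfold Rsqr in E; lra.
  - intros t.
    assert (Hd : forall t, is_derive (fun t => th (t + L) - th t) t 0).
    { intros s. pose proof (Hth s) as H1. pose proof (Hth (s + L)) as H2.
      auto_derive; [split; [|split]; try exact I; eexists; eassumption|].
      change (Derive (fun x : R => th x) s) with (Derive th s).
      change (Derive (fun x : R => th x) (s + L)) with (Derive th (s + L)).
      rewrite (is_derive_unique _ _ _ H1), (is_derive_unique _ _ _ H2).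
      rewrite PX, PY, (is_derive_periodic X X' L HX PX), (is_derive_periodic Y Y' L HY PY). ring. }
    pose proof (derive_zero_const _ Hd t 0) as E; cbv beta in E. rewrite Rplus_0_l in E. lra.
Qed.

(* If the polar angle grew by more than [2 PI] over a period, the radius, as a
   function of the polar angle [a], would satisfy [rho (a + 2 PI) <= rho a] at its
   maximum and [rho (a + 2 PI) >= rho a] one turn earlier: a self-intersection. *)
Lemma simple_star_winding (X Y th : R -> R) (L c : R) :
  0 < L -> 0 < c -> cos c = 1 ->
  (forall t, continuous X t) -> (forall t, continuous Y t) ->
  (forall t, X (t + L) = X t /\ Y (t + L) = Y t) ->
  (forall s t, 0 <= s < L -> 0 <= t < L -> (X s, Y s) = (X t, Y t) -> s = t) ->
  (forall t, continuous th t) -> (forall s t, s < t -> th s < th t) ->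
  (forall t, th (t + L) = th t + c) ->
  (forall t, (X t, Y t) = vscale (vnorm (X t, Y t)) (dir (th t))) ->
  c = 2 * PI.
Proof.
  intros HL Hc Hcos cX cY Hper Hinj cth Hinc Hth Hpol.
  pose proof (cos_one_ge_2PI c Hc Hcos) as Hge.
  apply Rle_antisym; [|exact Hge]. apply Rnot_lt_le; intros Hgt.
  pose proof PI_RGT_0 as Hpi.
  destruct (increasing_inverse th Hinc (quasiperiodic_surjective th L c HL Hc cth Hth))
    as [g [Hg1 [Hg2 cg]]].
  assert (Hginc : forall a b, a < b -> g a < g b).
  { intros a b Hab. destruct (Rtotal_order (g a) (g b)) as [E|[E|E]]; [exact E| |].
    - apply (f_equal th) in E. rewrite !Hg1 in E; lra.
    - apply Hinc in E. rewrite !Hg1 in E; lra. }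
  assert (Hgc : forall a, g (a + c) = g a + L).
  { intros a. rewrite <- (Hg2 (g a + L)). now rewrite Hth, Hg1. }
  set (q := fun t => vnorm (X t, Y t)).
  assert (cq : forall t, continuous q t).
  { intros t. unfold q, vnorm, dot; simpl.
    apply (continuous_comp (fun t => X t * X t + Y t * Y t) sqrt).
    - apply (continuous_plus (V := R_NormedModule)); apply (continuous_mult (K := R_AbsRing)); auto.
    - apply continuous_sqrt. }
  assert (Hq : forall t, q (t + L) = q t).
  { intros t; unfold q. destruct (Hper t) as [-> ->]. reflexivity. }
  (* [t0] is a parameter of maximal radius. *)
  destruct (periodic_bounded_below (fun t => - q t) L HL) as [t0 Ht0].
  { intros t; apply (continuous_opp (V := R_NormedModule)), cq. }
  { intros t; now rewrite Hq. }
  set (rho := fun a => q (g a)).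
  assert (crho : forall a, continuous rho a).
  { intros a; apply (continuous_comp g q); auto. }
  assert (Hz : exists a, rho (a + 2 * PI) = rho a).
  { set (a0 := th t0). set (d := fun a => rho (a + 2 * PI) - rho a).
    assert (Hd0 : d a0 <= 0).
    { unfold d, rho, a0. rewrite Hg2. specialize (Ht0 (g (th t0 + 2 * PI))). simpl in Ht0; lra. }
    assert (Hd1 : 0 <= d (a0 - 2 * PI)).
    { unfold d, rho, a0. replace (th t0 - 2 * PI + 2 * PI) with (th t0) by ring. rewrite Hg2.
      specialize (Ht0 (g (th t0 - 2 * PI))). simpl in Ht0; lra. }
    (* [IVT_sign] needs strict signs, so a zero of [d] at either end is treated separately. *)
    destruct (Req_dec (d a0) 0) as [E|E]; [exists a0; unfold d in E; lra|].
    destruct (Req_dec (d (a0 - 2 * PI)) 0) as [E'|E']; [exists (a0 - 2 * PI); unfold d in E'; lra|].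
    destruct (IVT_sign d (a0 - 2 * PI) a0) as [a [_ Ha]].
    - intros a. apply (continuous_minus (V := R_NormedModule)); [|apply crho].
      apply (continuous_comp (fun a => a + 2 * PI) rho); [|apply crho].
      apply (continuous_plus (V := R_NormedModule)); [apply continuous_id|apply continuous_const].
    - lra.
    - nra.
    - exists a; unfold d in Ha; lra. }
  destruct Hz as [a Ha].
  apply (simple_injective (fun t => (X t, Y t)) L HL) with (s := g a) (t := g (a + 2 * PI)).
  - intros t; destruct (Hper t) as [-> ->]; reflexivity.
  - exact Hinj.
  (* Since [2 * PI < c], the second parameter comes less than one period after the first. *)
  - split; [apply Hginc; lra|]. rewrite <- Hgc. apply Hginc; lra.
  - rewrite (Hpol (g a)), (Hpol (g (a + 2 * PI))), !Hg1.
    unfold rho, q in Ha. rewrite Ha. unfold dir.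
    rewrite cos_plus, sin_plus, cos_2PI, sin_2PI. do 2 f_equal; ring.
Qed.

(** * Convexity of ovals *)

(* [phi t] is the angle of the tangent at [curve x y t], [h] a lower bound of the
   support function with respect to [O]. *)
Record convex_frame (x y phi : R -> R) (O : pt) (h C : R) : Prop := {
  frame_derive_x : forall t, ex_derive x t;
  frame_derive_y : forall t, ex_derive y t;
  frame_derive_phi : forall t, ex_derive phi t;
  frame_increasing : forall s t, s < t -> phi s < phi t;
  frame_surjective : forall a, exists t, phi t = a;
  frame_speed : forall t, 0 < vnorm (tangent x y t);
  frame_tangent : forall t, tangent x y t = vscale (vnorm (tangent x y t)) (dir (phi t));
  frame_convex : forall s t, 0 <= cross (dir (phi s)) (vsub (curve x y t) (curve x y s));
  frame_h_pos : 0 < h;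
  frame_support : forall t, h <= cross (dir (phi t)) (vsub O (curve x y t));
  frame_bounded : forall t, vnorm (vsub (curve x y t) O) <= C
}.

Lemma ex_derive_continuous_R (f : R -> R) (t : R) : ex_derive f t -> continuous f t.
Proof. apply (ex_derive_continuous (K := R_AbsRing) (V := R_NormedModule)). Qed.

Lemma increasing_le (f : R -> R) :
  (forall s t, s < t -> f s < f t) -> forall s t, s <= t -> f s <= f t.
Proof. intros Hf s t [Hst| ->]; [left; auto|right; reflexivity]. Qed.

Lemma dir_2PI (a : R) : dir (a + 2 * PI) = dir a.
Proof.
  unfold dir. rewrite cos_plus, sin_plus, cos_2PI, sin_2PI. f_equal; ring.
Qed.

Lemma cross_dir (a b : R) : cross (dir a) (dir b) = sin (b - a).
Proof. unfold cross, dir; simpl. rewrite sin_minus. ring. Qed.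

(** The height of the curve above its tangent line at [s] has derivative the speed times
    [sin (phi t - phi s)]. With a tangent turning exactly once, the height rises while the turn is
    below [PI] and falls afterwards; it vanishes at both ends of the period, hence is nonnegative in
    between. *)
Lemma convex_of_turning (x y phi : R -> R) (L : R) :
  0 < L ->
  (forall t, ex_derive x t) -> (forall t, ex_derive y t) ->
  (forall t, x (t + L) = x t /\ y (t + L) = y t) ->
  (forall t, continuous phi t) -> (forall s t, s < t -> phi s < phi t) ->
  (forall t, phi (t + L) = phi t + 2 * PI) ->
  (forall t, tangent x y t = vscale (vnorm (tangent x y t)) (dir (phi t))) ->
  forall s t, 0 <= cross (dir (phi s)) (vsub (curve x y t) (curve x y s)).
Proof.
  intros HL Hx Hy Hper cphi Hinc Hphi Htan s t.
  pose proof PI_RGT_0 as Hpi.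
  set (g := fun t => cross (dir (phi s)) (vsub (curve x y t) (curve x y s))).
  assert (Hg : forall t, is_derive g t (vnorm (tangent x y t) * sin (phi t - phi s))).
  { intros u. rewrite <- cross_dir.
    replace (vnorm (tangent x y u) * cross (dir (phi s)) (dir (phi u)))
      with (cross (dir (phi s)) (tangent x y u))
      by (rewrite (Htan u) at 1; unfold cross, vscale; simpl; ring).
    unfold g, cross, vsub, curve, tangent; simpl.
    auto_derive; [repeat split; auto|].
    change (Derive (fun x0 : R => x x0) u) with (Derive x u).
    change (Derive (fun x0 : R => y x0) u) with (Derive y u). ring. }
  assert (Hgs : g s = 0) by (unfold g, cross, vsub; simpl; ring).
  assert (Hgper : forall t, g (t + L) = g t).
  { intros u; unfold g, curve. destruct (Hper u) as [-> ->]. reflexivity. }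
  (* At [m] the tangent is antiparallel to the one at [s], and the height [g] is largest. *)
  destruct (IVT_sign (fun u => phi u - (phi s + PI)) s (s + L)) as [m [Hm Hmz]].
  { intros u; apply (continuous_minus (V := R_NormedModule)); [apply cphi|apply continuous_const]. }
  { lra. }
  { rewrite Hphi. nra. }
  assert (Hle : forall u v, s <= u -> u <= v -> v <= m -> g u <= g v).
  { intros u v H1 H2 H3.
    destruct (MVT_gen g u v (fun t => vnorm (tangent x y t) * sin (phi t - phi s))) as [z [Hz Ez]].
    - intros; apply Hg.
    - intros; eapply continuity_pt_filterlim, is_derive_continuous, Hg.
    - rewrite Rmin_left, Rmax_right in Hz by lra.
      assert (phi s <= phi z) by (apply increasing_le; auto; lra).
      assert (phi z <= phi m) by (apply increasing_le; auto; lra).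
      assert (0 <= sin (phi z - phi s)) by (apply sin_ge_0; lra).
      assert (0 <= vnorm (tangent x y z)) by apply sqrt_pos.
      assert (0 <= vnorm (tangent x y z) * sin (phi z - phi s)) by now apply Rmult_le_pos.
      assert (0 <= vnorm (tangent x y z) * sin (phi z - phi s) * (v - u)) by (apply Rmult_le_pos; lra).
      lra. }
  assert (Hge : forall u v, m <= u -> u <= v -> v <= s + L -> g v <= g u).
  { intros u v H1 H2 H3.
    destruct (MVT_gen g u v (fun t => vnorm (tangent x y t) * sin (phi t - phi s))) as [z [Hz Ez]].
    - intros; apply Hg.
    - intros; eapply continuity_pt_filterlim, is_derive_continuous, Hg.
    - rewrite Rmin_left, Rmax_right in Hz by lra.
      pose proof (Hphi s) as Hps.
      assert (phi m <= phi z) by (apply increasing_le; auto; lra).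
      assert (phi z <= phi (s + L)) by (apply increasing_le; auto; lra).
      assert (sin (phi z - phi s) <= 0) by (apply sin_le_0; lra).
      assert (0 <= vnorm (tangent x y z)) by apply sqrt_pos.
      assert (0 <= vnorm (tangent x y z) * - sin (phi z - phi s)) by (apply Rmult_le_pos; lra).
      assert (0 <= vnorm (tangent x y z) * - sin (phi z - phi s) * (v - u)) by (apply Rmult_le_pos; lra).
      lra. }
  change (0 <= g t).
  destruct (period_representative L s t HL) as [k Hk].
  rewrite <- (periodic_Z g L Hgper k t). set (u := t + IZR k * L) in *.
  destruct (Rle_dec u m) as [Hum|Hum].
  - rewrite <- Hgs. apply Hle; lra.
  - rewrite <- Hgs, <- Hgper. apply Hge; lra.
Qed.

Lemma oval_convex_frame (x y : R -> R) (L : R) (O : pt) :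
  is_oval x y L -> in_interior_K x y O ->
  exists phi h C, convex_frame x y phi O h C.
Proof.
  intros (HL & Hper & Hsm & Hinj & Hcurv) Hint.
  pose proof PI_RGT_0 as Hpi.
  assert (dx : forall t, is_derive x t (Derive x t)) by (intros t; apply Derive_correct, (Hsm 0%nat t)).
  assert (dy : forall t, is_derive y t (Derive y t)) by (intros t; apply Derive_correct, (Hsm 0%nat t)).
  assert (ddx : forall t, is_derive (Derive x) t (Derive_n x 2 t)) by (intros t; apply Derive_correct, (Hsm 1%nat t)).
  assert (ddy : forall t, is_derive (Derive y) t (Derive_n y 2 t)) by (intros t; apply Derive_correct, (Hsm 1%nat t)).
  assert (cx2 : forall t, continuous (Derive_n x 2) t) by (intros t; apply ex_derive_continuous_R, (Hsm 2%nat t)).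
  assert (cy2 : forall t, continuous (Derive_n y 2) t) by (intros t; apply ex_derive_continuous_R, (Hsm 2%nat t)).
  set (X := fun t => x t - fst O). set (Y := fun t => y t - snd O).
  assert (dX : forall t, is_derive X t (Derive x t)).
  { intros t; unfold X. replace (Derive x t) with (Derive x t - 0) by ring.
    apply (is_derive_minus (V := R_NormedModule) x (fun _ => fst O)); [apply dx|].
    apply (is_derive_const (V := R_NormedModule)). }
  assert (dY : forall t, is_derive Y t (Derive y t)).
  { intros t; unfold Y. replace (Derive y t) with (Derive y t - 0) by ring.
    apply (is_derive_minus (V := R_NormedModule) y (fun _ => snd O)); [apply dy|].
    apply (is_derive_const (V := R_NormedModule)). }
  assert (Hcr : forall t, 0 < X t * Derive y t - Y t * Derive x t).
  { intros t. specialize (Hint t). unfold cross, tangent, vsub, curve in Hint; simpl in Hint.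
    unfold X, Y. lra. }
  assert (HN : forall t, 0 < X t * X t + Y t * Y t).
  { intros t. specialize (Hcr t). destruct (Req_dec (X t) 0) as [E|E]; [|nra].
    destruct (Req_dec (Y t) 0) as [E'|E']; [|nra]. rewrite E, E' in Hcr. lra. }
  assert (HT : forall t, 0 < Derive x t * Derive x t + Derive y t * Derive y t).
  { intros t. specialize (Hcr t). destruct (Req_dec (Derive x t) 0) as [E|E]; [|nra].
    destruct (Req_dec (Derive y t) 0) as [E'|E']; [|nra]. rewrite E, E' in Hcr. lra. }
  assert (PX : forall t, X (t + L) = X t) by (intros t; unfold X; now rewrite (proj1 (Hper t))).
  assert (PY : forall t, Y (t + L) = Y t) by (intros t; unfold Y; now rewrite (proj2 (Hper t))).
  pose proof (is_derive_periodic X _ L dX PX) as PX'.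
  pose proof (is_derive_periodic Y _ L dY PY) as PY'.
  destruct (angle_lift X Y (Derive x) (Derive y)) as [th [dth Hth]]; auto.
  { intros t; eapply is_derive_continuous, ddx. }
  { intros t; eapply is_derive_continuous, ddy. }
  destruct (angle_lift (Derive x) (Derive y) (Derive_n x 2) (Derive_n y 2)) as [phi [dphi Hphi]]; auto.
  destruct (angle_lift_period X Y (Derive x) (Derive y) th L) as [c [Hc1 Hc]]; auto.
  destruct (angle_lift_period (Derive x) (Derive y) (Derive_n x 2) (Derive_n y 2) phi L)
    as [c' [Hc1' Hc']]; auto.
  assert (th_inc : forall s t, s < t -> th s < th t).
  { eapply is_derive_increasing; [exact dth|].
    intros t; apply Rdiv_lt_0_compat; auto. }
  assert (phi_inc : forall s t, s < t -> phi s < phi t).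
  { eapply is_derive_increasing; [exact dphi|].
    intros t; apply Rdiv_lt_0_compat; auto. apply Hcurv. }
  assert (cth : forall t, continuous th t) by (intros t; eapply is_derive_continuous, dth).
  assert (cphi : forall t, continuous phi t) by (intros t; eapply is_derive_continuous, dphi).
  assert (Hcpos : 0 < c) by (pose proof (th_inc 0 (0 + L)); pose proof (Hc 0); lra).
  assert (Hcpos' : 0 < c') by (pose proof (phi_inc 0 (0 + L)); pose proof (Hc' 0); lra).
  assert (Ec : c = 2 * PI).
  { apply (simple_star_winding X Y th L c); auto.
    - intros t; eapply is_derive_continuous, dX.
    - intros t; eapply is_derive_continuous, dY.
    - intros s t Hs Ht E. apply Hinj; auto. unfold X, Y in E. injection E as E1 E2.
      unfold curve; f_equal; lra. }
  (* The tangent points to the left of the position vector, so [phi - th] never meets a multiple of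
     [PI]. *)
  assert (Hsin : forall t, 0 < sin (phi t - th t)).
  { intros t. pose proof (Hcr t) as H.
    pose proof (f_equal fst (Hth t)) as H1; pose proof (f_equal snd (Hth t)) as H2.
    pose proof (f_equal fst (Hphi t)) as H3; pose proof (f_equal snd (Hphi t)) as H4.
    simpl in H1, H2, H3, H4.
    set (n1 := vnorm _) in H1, H2. set (n2 := vnorm _) in H3, H4.
    assert (0 <= n1) by apply sqrt_pos. assert (0 <= n2) by apply sqrt_pos.
    rewrite H1, H2, H3, H4 in H.
    replace (n1 * cos (th t) * (n2 * sin (phi t)) - n1 * sin (th t) * (n2 * cos (phi t)))
      with ((n1 * n2) * sin (phi t - th t)) in H by (rewrite sin_minus; ring).
    assert (0 <= n1 * n2) by nra. nra. }
  (* A turn above [2 * PI] would be at least [4 * PI], so over one period [phi - th] would grow by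
     at least [2 * PI]. It would then reach its initial value plus [PI], where the sine has the
     opposite sign. *)
  assert (Ec' : c' = 2 * PI).
  { apply Rle_antisym; [|now apply cos_one_ge_2PI]. apply Rnot_lt_le; intros Hgt.
    assert (H4 : 2 * PI <= c' - 2 * PI).
    { apply cos_one_ge_2PI; [lra|]. rewrite cos_minus, cos_2PI, sin_2PI. lra. }
    pose proof (Hc 0) as H0; pose proof (Hc' 0) as H0'. rewrite Rplus_0_l in H0, H0'.
    destruct (IVT_sign (fun t => (phi t - th t) - (phi 0 - th 0 + PI)) 0 L) as [t [_ Ht]].
    - intros t. apply (continuous_minus (V := R_NormedModule)); [|apply continuous_const].
      apply (continuous_minus (V := R_NormedModule)); auto.
    - exact HL.
    - rewrite H0, H0', Ec. nra.
    - pose proof (Hsin t) as Hs. pose proof (Hsin 0) as Hs0.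
      replace (phi t - th t) with (phi 0 - th 0 + PI) in Hs by lra.
      rewrite neg_sin in Hs. lra. }
  rewrite Ec' in Hc'.
  set (H := fun t => cross (dir (phi t)) (vsub O (curve x y t))).
  assert (Htan : forall t, tangent x y t = vscale (vnorm (tangent x y t)) (dir (phi t))) by exact Hphi.
  assert (Hsp : forall t, 0 < vnorm (tangent x y t)) by (intros t; apply sqrt_lt_R0, HT).
  assert (HHpos : forall t, 0 < H t).
  { intros t. pose proof (Hint t) as Hi. rewrite Htan in Hi. pose proof (Hsp t) as Hs.
    set (n := vnorm _) in *. unfold H.
    replace (cross (vscale n (dir (phi t))) (vsub O (curve x y t)))
      with (n * cross (dir (phi t)) (vsub O (curve x y t))) in Hi
      by (unfold cross, vscale; simpl; ring). nra. }
  assert (Hx : forall t, ex_derive x t) by (intros t; eexists; apply dx).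
  assert (Hy : forall t, ex_derive y t) by (intros t; eexists; apply dy).
  assert (Hp : forall t, ex_derive phi t) by (intros t; eexists; apply dphi).
  (* [h] is the minimum of the support function and [C], found next, the maximum of the distance to
     [O]; both are attained by periodicity. *)
  destruct (periodic_bounded_below H L HL) as [t0 Ht0].
  { intros t; apply ex_derive_continuous_R. unfold H, cross, vsub, dir, curve; simpl.
    auto_derive; repeat split; auto. }
  { intros t; unfold H. rewrite Hc', dir_2PI. unfold curve. now rewrite (proj1 (Hper t)), (proj2 (Hper t)). }
  destruct (periodic_bounded_below (fun t => - vnorm (vsub (curve x y t) O)) L HL) as [t1 Ht1].
  { intros t; apply ex_derive_continuous_R. unfold vnorm, dot, vsub, curve; simpl.
    auto_derive; repeat split; auto. apply (HN t). }
  { intros t; unfold curve. now rewrite (proj1 (Hper t)), (proj2 (Hper t)). }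
  exists phi, (H t0), (vnorm (vsub (curve x y t1) O)). constructor; auto.
  - apply (quasiperiodic_surjective phi L (2 * PI)); auto. lra.
  - apply (convex_of_turning x y phi L); auto.
  - intros t. specialize (Ht1 t). simpl in Ht1. lra.
Qed.

(** * Estimates for the outer length billiard map *)

Lemma dir_unit (a : R) : cos a * cos a + sin a * sin a = 1.
Proof. pose proof (sin2_cos2 a) as E; unfold Rsqr in E; lra. Qed.

Lemma vnorm_sqr (v : pt) : vnorm v * vnorm v = dot v v.
Proof. apply sqrt_sqrt. unfold dot; nra. Qed.

Lemma vnorm_pos (v : pt) : 0 <= vnorm v.
Proof. apply sqrt_pos. Qed.

Lemma vnorm_vscale_dir (l a : R) : 0 <= l -> vnorm (vscale l (dir a)) = l.
Proof.
  intros Hl. unfold vnorm, dot, vscale, dir; simpl.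
  replace (l * cos a * (l * cos a) + l * sin a * (l * sin a))
    with (l * l * (cos a * cos a + sin a * sin a)) by ring.
  rewrite dir_unit, Rmult_1_r. now apply sqrt_square.
Qed.

Lemma abs_le_of_sqr (u c : R) : 0 <= c -> u * u <= c * c -> - c <= u <= c.
Proof. intros; split; nra. Qed.

(** Lagrange's identity: for a unit vector, the squares of the cross and dot products with [v] add
    up to the squared norm of [v]. *)
Lemma cross_sqr_le (g1 g2 v1 v2 : R) :
  g1 * g1 + g2 * g2 = 1 -> (g1 * v2 - g2 * v1) * (g1 * v2 - g2 * v1) <= v1 * v1 + v2 * v2.
Proof.
  intros E.
  assert (H : (g1 * v2 - g2 * v1) * (g1 * v2 - g2 * v1) + (g1 * v1 + g2 * v2) * (g1 * v1 + g2 * v2)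
    = (g1 * g1 + g2 * g2) * (v1 * v1 + v2 * v2)) by ring.
  rewrite E in H. pose proof (Rle_0_sqr (g1 * v1 + g2 * v2)) as H0; unfold Rsqr in H0. lra.
Qed.

Lemma dot_sqr_le (g1 g2 v1 v2 : R) :
  g1 * g1 + g2 * g2 = 1 -> (g1 * v1 + g2 * v2) * (g1 * v1 + g2 * v2) <= v1 * v1 + v2 * v2.
Proof.
  intros E.
  assert (H : (g1 * v2 - g2 * v1) * (g1 * v2 - g2 * v1) + (g1 * v1 + g2 * v2) * (g1 * v1 + g2 * v2)
    = (g1 * g1 + g2 * g2) * (v1 * v1 + v2 * v2)) by ring.
  rewrite E in H. pose proof (Rle_0_sqr (g1 * v2 - g2 * v1)) as H0; unfold Rsqr in H0. lra.
Qed.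

(** The distance from [O] to a tangent line is at most the distance from [O] to the tangency
    point. *)
Lemma frame_h_le_C (x y phi : R -> R) (O : pt) (h C : R) :
  convex_frame x y phi O h C -> h <= C.
Proof.
  intros Hf. pose proof (frame_support _ _ _ _ _ _ Hf 0) as H1.
  pose proof (frame_bounded _ _ _ _ _ _ Hf 0) as H2.
  pose proof (frame_h_pos _ _ _ _ _ _ Hf) as H0.
  pose proof (vnorm_pos (vsub (curve x y 0) O)) as H3.
  pose proof (vnorm_sqr (vsub (curve x y 0) O)) as H4.
  pose proof (cross_sqr_le (cos (phi 0)) (sin (phi 0)) (fst O - x 0) (snd O - y 0) (dir_unit _)) as H5.
  unfold cross, vsub, dir, curve, dot in *; simpl in *. nra.
Qed.

Lemma frame_bounded_sqr (x y phi : R -> R) (O : pt) (h C : R) (t : R) :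
  convex_frame x y phi O h C ->
  (x t - fst O) * (x t - fst O) + (y t - snd O) * (y t - snd O) <= C * C.
Proof.
  intros Hf. pose proof (frame_bounded _ _ _ _ _ _ Hf t) as H2.
  pose proof (vnorm_pos (vsub (curve x y t) O)) as H3.
  pose proof (vnorm_sqr (vsub (curve x y t) O)) as H4.
  unfold vsub, curve, dot in *; simpl in *. nra.
Qed.

(* With [l = r tan (eps / 2)] and [ls = r tan (eta / 2)], where [eps] and [eta]
   are the angles of sine [sg], [sgs] and cosine [- q], [- k]: the steeper of the two
   tangents meets the line at the larger distance, by the circle, and at the
   smaller one, by convexity of the curve. *)
Lemma back_tangent_unique (l l' ls ls' r sg q sgs k : R) :
  q * q + sg * sg = 1 -> k * k + sgs * sgs = 1 -> 0 < sg -> 0 < sgs -> 0 < r ->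
  l * sg = r * (1 + q) -> ls * sgs = r * (1 + k) -> 0 < l' -> 0 <= ls' ->
  ls' * (sg * k - q * sgs) <= (l - ls) * sg ->
  (l - ls) * sgs <= l' * (sg * k - q * sgs) ->
  q = k /\ sg = sgs /\ l = ls.
Proof.
  intros E1 E2 Hsg Hsgs Hr El Els Hl' Hls' H1 H2.
  (* [a] and [b] are the tangents of [eps / 2] and [eta / 2]. The facts below are the half-angle
     formulas, which make everything rational in [a] and [b]. *)
  set (a := l / r). set (b := ls / r).
  assert (Ea : l = r * a) by (unfold a; field; lra).
  assert (Eb : ls = r * b) by (unfold b; field; lra).
  clearbody a b. subst l ls.
  assert (Fa : a * sg = 1 + q) by (apply Rmult_eq_reg_l with r; lra).
  assert (Fb : b * sgs = 1 + k) by (apply Rmult_eq_reg_l with r; lra).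
  assert (Ga : a * (1 - q) = sg).
  { apply Rmult_eq_reg_r with sg; [|lra].
    replace (a * (1 - q) * sg) with ((1 - q) * (a * sg)) by ring. rewrite Fa. lra. }
  assert (Gb : b * (1 - k) = sgs).
  { apply Rmult_eq_reg_r with sgs; [|lra].
    replace (b * (1 - k) * sgs) with ((1 - k) * (b * sgs)) by ring. rewrite Fb. lra. }
  assert (Ha : 0 < a).
  { assert (-1 < q) by (assert (q * q < 1) by nra; nra). nra. }
  assert (Hb : 0 < b).
  { assert (-1 < k) by (assert (k * k < 1) by nra; nra). nra. }
  set (na := 1 + a * a). set (nb := 1 + b * b).
  assert (Hna : 0 < na) by (unfold na; nra). assert (Hnb : 0 < nb) by (unfold nb; nra).
  assert (Qa : q = (a * a - 1) / na) by (apply Rmult_eq_reg_r with na; [|lra]; field_simplify; [|lra]; unfold na; nra).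
  assert (Sa : sg = 2 * a / na) by (apply Rmult_eq_reg_r with na; [|lra]; field_simplify; [|lra]; unfold na; nra).
  assert (Qb : k = (b * b - 1) / nb) by (apply Rmult_eq_reg_r with nb; [|lra]; field_simplify; [|lra]; unfold nb; nra).
  assert (Sb : sgs = 2 * b / nb) by (apply Rmult_eq_reg_r with nb; [|lra]; field_simplify; [|lra]; unfold nb; nra).
  (* The left side is [sin (eta - eps)], with the sign of [b - a]. So [a < b] contradicts the first
     inequality and [b < a] the second. *)
  assert (EX : sg * k - q * sgs = (b - a) * (2 * (1 + a * b) / (na * nb))).
  { rewrite Qa, Sa, Qb, Sb. field. lra. }
  assert (HX : 0 < 2 * (1 + a * b) / (na * nb)) by (apply Rdiv_lt_0_compat; nra).
  rewrite EX in H1, H2. set (X := 2 * (1 + a * b) / (na * nb)) in *. clearbody X.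
  assert (Eab : a = b).
  { destruct (Rtotal_order a b) as [H|[H|H]]; [|exact H|]; exfalso.
    - assert (0 <= ls' * ((b - a) * X)) by (apply Rmult_le_pos; nra).
      assert ((r * a - r * b) * sg < 0).
      { replace ((r * a - r * b) * sg) with (- (r * (b - a) * sg)) by ring.
        assert (0 < r * (b - a) * sg) by (repeat apply Rmult_lt_0_compat; lra). lra. }
      lra.
    - assert (0 < (r * a - r * b) * sgs).
      { replace ((r * a - r * b) * sgs) with (r * (a - b) * sgs) by ring.
        repeat apply Rmult_lt_0_compat; lra. }
      assert (l' * ((b - a) * X) < 0).
      { replace (l' * ((b - a) * X)) with (- (l' * ((a - b) * X))) by ring.
        assert (0 < l' * ((a - b) * X)) by (repeat apply Rmult_lt_0_compat; lra). lra. }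
      lra. }
  assert (Enn : na = nb) by (unfold na, nb; now rewrite Eab).
  repeat split.
  - now rewrite Qa, Qb, Enn, Eab.
  - now rewrite Sa, Sb, Enn, Eab.
  - now rewrite Eab.
Qed.

(* The inequalities behind the asymptotics [r ~ l ^ 2], [m ~ l]. *)
Lemma front_distance_bound (h C l r sg q f k j m : R) :
  0 < h -> h <= C -> 2 * C < l -> 32 * C ^ 4 <= h ^ 2 * l ^ 2 ->
  q * q + sg * sg = 1 -> 0 < sg -> q <= 0 -> 0 < r ->
  l * sg = r * (1 + q) -> l * sg <= 2 * C ->
  k * k + j * j = 1 -> f = r * (1 + k) -> f <= 2 * C -> f = m * j ->
  (k <= 0 -> h - Rabs j * C <= f) ->
  j <> 0 /\ (0 < j -> 0 < m /\ h * l ^ 2 <= 16 * C * m ^ 2).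
Proof.
  (* [q] and [sg] are the cosine and sine of the angle between the oriented tangents through [A];
     [k] and [j] are those of the turn from the line [A x_+] to the third tangent. [f] is the
     distance from [x_+] to the third tangent, and [m] the signed distance from [x_+] to the
     image. *)
  intros Hh HhC Hl Hl2 Eq Hsg Hq Hr El Hlsg Ek Ef HfC Efm Hlow.
  assert (H1q : 0 < 1 + q) by nra.
  assert (Erq : r * sg = l * (1 - q)).
  { apply Rmult_eq_reg_r with (1 + q); [|lra].
    replace (l * (1 - q) * (1 + q)) with (l * (1 - q * q)) by ring.
    replace (1 - q * q) with (sg * sg) by lra.
    replace (r * sg * (1 + q)) with (r * (1 + q) * sg) by ring. rewrite <- El. ring. }
  assert (Hr2 : l ^ 2 <= 2 * C * r).
  { assert (l <= r * sg) by nra. 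
    assert (l * l <= l * (r * sg)) by (apply Rmult_le_compat_l; lra).
    assert (l * sg * r <= 2 * C * r) by (apply Rmult_le_compat_r; lra).
    simpl; lra. }
  (* From [l > 2 * C] follows [r > 2 * C]; since [r * (1 + k) <= 2 * C], [k] cannot be positive. *)
  assert (Hk0 : k <= 0).
  { assert (4 * C ^ 2 < l ^ 2) by nra.
    assert (2 * C < r) by nra. nra. }
  assert (Hj2 : l ^ 2 * (j * j) <= 8 * C ^ 2).
  { assert (j * j = (1 - k) * (1 + k)) by lra.
    assert (-1 <= k) by nra.
    assert (j * j <= 2 * (1 + k)) by nra.
    assert (l ^ 2 * (1 + k) <= 2 * C * r * (1 + k)) by (apply Rmult_le_compat_r; lra).
    assert (l ^ 2 * (j * j) <= l ^ 2 * (2 * (1 + k))) by (apply Rmult_le_compat_l; [apply pow2_ge_0|lra]).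
    nra. }
  (* The constant 32 is chosen here: it turns [j ^ 2 <= 8 * C ^ 2 / l ^ 2] into
     [Rabs j * C <= h / 2]. *)
  assert (Hf : h / 2 <= f).
  { assert (HjC : Rabs j * C <= h / 2).
    { set (J := Rabs j). assert (HJ : J * J = j * j) by (unfold J; rewrite <- Rabs_mult, Rabs_right; nra).
      assert (HJ0 : 0 <= J) by apply Rabs_pos. rewrite <- HJ in Hj2.
      apply Rnot_lt_le; intros Hlt.
      assert (H1 : h ^ 2 / 4 < (J * C) * (J * C)) by nra.
      assert (Hl0 : 0 < l ^ 2) by nra.
      assert (H2 : h ^ 2 / 4 * l ^ 2 < (J * C) * (J * C) * l ^ 2) by (apply Rmult_lt_compat_r; lra).
      assert (H3 : (J * C) * (J * C) * l ^ 2 <= 8 * C ^ 2 * (C * C)).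
      { replace ((J * C) * (J * C) * l ^ 2) with (l ^ 2 * (J * J) * (C * C)) by ring.
        apply Rmult_le_compat_r; nra. }
      nra. }
    specialize (Hlow Hk0). lra. }
  split; [intros E; rewrite E in Efm; lra|].
  intros Hj.
  assert (Hm : 0 < m) by nra.
  split; [exact Hm|].
  assert (H1k : 0 < 1 + k) by nra.
  assert (Emk : m * (1 - k) = r * j).
  { apply Rmult_eq_reg_r with (1 + k); [|lra].
    replace (m * (1 - k) * (1 + k)) with (m * (1 - k * k)) by ring.
    replace (1 - k * k) with (j * j) by lra.
    replace (r * j * (1 + k)) with (r * (1 + k) * j) by ring. rewrite <- Ef, Efm. ring. }
  (* Origin of the constant 16: as [1 <= 1 - k <= 2], one has [r * f <= (r * j) ^ 2 <= 4 * m ^ 2],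
     while [f >= h / 2] and [2 * C * r >= l ^ 2]. *)
  assert (Hrj : r * j <= 2 * m) by nra.
  assert (Hrj2 : r * f <= (r * j) * (r * j)).
  { assert (1 + k <= j * j) by nra. rewrite Ef.
    replace (r * j * (r * j)) with (r * r * (j * j)) by ring.
    replace (r * (r * (1 + k))) with (r * r * (1 + k)) by ring.
    apply Rmult_le_compat_l; nra. }
  assert (Hrj0 : 0 < r * j) by nra.
  assert ((r * j) * (r * j) <= 4 * m ^ 2) by nra.
  assert (r * (h / 2) <= r * f) by (apply Rmult_le_compat_l; lra).
  assert (l ^ 2 * h <= 2 * C * r * h) by (apply Rmult_le_compat_r; lra).
  nra.
Qed.

(** The witnesses [l] and [m] are the distances from [x_+] back to [A] and forward to [B]. Once the
    equations of the circle and of the third tangent are written in the orthonormal frame at [x_+],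
    convexity excludes the unwanted common tangents and [front_distance_bound] compares [m] with
    [l]. *)
Lemma is_F_far_estimate (x y phi : R -> R) (O A B : pt) (h C N : R) :
  convex_frame x y phi O h C -> is_F x y A B ->
  2 * C < N -> 32 * C ^ 4 <= h ^ 2 * N ^ 2 -> C + N <= vnorm (vsub A O) ->
  exists t l m,
    N <= l /\ 0 < m /\ h * l ^ 2 <= 16 * C * m ^ 2 /\
    A = vsub (curve x y t) (vscale l (dir (phi t))) /\
    B = vadd (curve x y t) (vscale m (dir (phi t))).
Proof.
  intros Hf HF HN HN2 Hfar.
  destruct HF as (_ & tp & tm & lp & lm & Hlp & Hlm & Hu & Hw & HF). cbv zeta in HF.
  destruct HF as (c & r & Hr & (a & b & Ha & Hb & Hc) & Hcu & Hcr & Hcw & s & Hs & Hd1 & Hd2 & beta & HB & HBs).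
  pose proof (frame_speed _ _ _ _ _ _ Hf tp) as np. pose proof (frame_speed _ _ _ _ _ _ Hf tm) as nm.
  pose proof (frame_speed _ _ _ _ _ _ Hf s) as ns.
  rewrite (frame_tangent _ _ _ _ _ _ Hf tp) in Hu. rewrite (frame_tangent _ _ _ _ _ _ Hf tm) in Hw.
  rewrite (frame_tangent _ _ _ _ _ _ Hf s) in Hs, Hd1, Hd2, HBs.
  rewrite vnorm_vscale_dir in Hs by lra.
  set (nrp := vnorm (tangent x y tp)) in *. set (nrm := vnorm (tangent x y tm)) in *.
  set (n := vnorm (tangent x y s)) in *.
  assert (Hu' : vsub (curve x y tp) A = vscale (lp * nrp) (dir (phi tp)))
    by (rewrite Hu; unfold vscale; simpl; f_equal; ring).
  assert (Hw' : vsub A (curve x y tm) = vscale (lm * nrm) (dir (phi tm)))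
    by (rewrite Hw; unfold vscale; simpl; f_equal; ring).
  assert (Hl : 0 < lp * nrp) by nra. assert (Hl' : 0 < lm * nrm) by nra.
  set (l := lp * nrp) in *. set (l' := lm * nrm) in *.
  rewrite Hu' in Hc, Hcu, Hd1, HB. rewrite Hw' in Hc, Hcw, Hd2.
  rewrite vnorm_vscale_dir in Hcw by lra.
  clearbody l l' n. clear Hu Hw Hlp Hlm np nm nrp nrm lp lm.
  exists tp, l, ((beta - 1) * l).
  pose proof (frame_h_pos _ _ _ _ _ _ Hf) as Hh. pose proof (frame_h_le_C _ _ _ _ _ _ Hf) as HhC.
  pose proof (frame_convex _ _ _ _ _ _ Hf tp tm) as F1.
  pose proof (frame_convex _ _ _ _ _ _ Hf tp s) as F2.
  pose proof (frame_convex _ _ _ _ _ _ Hf tm s) as F3.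
  pose proof (frame_convex _ _ _ _ _ _ Hf s tp) as F4.
  pose proof (frame_convex _ _ _ _ _ _ Hf s tm) as F5.
  pose proof (frame_support _ _ _ _ _ _ Hf tp) as F6.
  pose proof (frame_support _ _ _ _ _ _ Hf s) as F7.
  pose proof (frame_bounded_sqr _ _ _ _ _ _ tp Hf) as Bp.
  pose proof (frame_bounded_sqr _ _ _ _ _ _ tm Hf) as Bm.
  pose proof (frame_bounded_sqr _ _ _ _ _ _ s Hf) as Bs.
  pose proof (vnorm_sqr (vsub A O)) as HAO. pose proof (vnorm_pos (vsub A O)) as HAO0.
  pose proof (vnorm_sqr (vsub c (curve x y tp))) as Hcr2. rewrite Hcr in Hcr2. clear Hcr.
  pose proof (dir_unit (phi tp)) as Ee. pose proof (dir_unit (phi tm)) as Ee'. pose proof (dir_unit (phi s)) as Eg.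
  clear Hf.
  destruct A as [A1 A2], B as [B1 B2], c as [c1 c2], O as [o1 o2].
  unfold distinct_lines, vsub, vadd, vscale, dir, curve, dot, cross in *; simpl in *.
  set (D := vnorm _) in *. clearbody D.
  set (e1 := cos (phi tp)) in *. set (e2 := sin (phi tp)) in *.
  set (f1 := cos (phi tm)) in *. set (f2 := sin (phi tm)) in *.
  set (g1 := cos (phi s)) in *. set (g2 := sin (phi s)) in *.
  set (p1 := x tp) in *. set (p2 := y tp) in *. set (m1 := x tm) in *. set (m2 := y tm) in *.
  set (s1 := x s) in *. set (s2 := y s) in *.
  clearbody e1 e2 f1 f2 g1 g2 p1 p2 m1 m2 s1 s2.
  injection Hu' as Hu1 Hu2. injection Hw' as Hw1 Hw2. injection Hc as Hc1 Hc2. injection HB as HB1 HB2.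
  assert (EA1 : A1 = p1 - l * e1) by lra. assert (EA2 : A2 = p2 - l * e2) by lra.
  assert (Em1 : m1 = p1 - l * e1 - l' * f1) by lra. assert (Em2 : m2 = p2 - l * e2 - l' * f2) by lra.
  clear Hu1 Hu2 Hw1 Hw2. subst A1 A2 m1 m2.
  (* The pairs [e], [f], [g] are the unit tangents at [x_+], [x_-] and the contact point of the
     third tangent; [q], [sg] and [k], [j] are the coordinates of the last two relative to the
     first. The scalar [f] is the signed distance from the third tangent to [x_+]. *)
  set (sg := f1 * e2 - f2 * e1). set (q := e1 * f1 + e2 * f2).
  set (k := e1 * g1 + e2 * g2). set (j := e1 * g2 - e2 * g1).
  set (f := g1 * (p2 - s2) - g2 * (p1 - s1)) in *.
  assert (Eq : q * q + sg * sg = 1).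
  { transitivity ((e1 * e1 + e2 * e2) * (f1 * f1 + f2 * f2)); [unfold q, sg; ring|]. rewrite Ee, Ee'; ring. }
  assert (Ek : k * k + j * j = 1).
  { transitivity ((e1 * e1 + e2 * e2) * (g1 * g1 + g2 * g2)); [unfold k, j; ring|]. rewrite Ee, Eg; ring. }
  assert (Hsg0 : 0 <= sg).
  { apply Rmult_le_reg_l with l'; [exact Hl'|]. unfold sg.
    replace (l' * (f1 * e2 - f2 * e1)) with
      (e1 * (p2 - l * e2 - l' * f2 - p2) - e2 * (p1 - l * e1 - l' * f1 - p1)) by ring. lra. }
  (* [kap] is the height of the centre above the line [A x_+]. Tangency makes it [r] or [- r], and a
     centre inside the angle lies on the right, so it is [- r]; this also forces [sg] to be
     nonzero. *)
  set (kap := e1 * (c2 - p2) - e2 * (c1 - p1)).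
  assert (Hdot : e1 * (c1 - p1) + e2 * (c2 - p2) = 0).
  { apply Rmult_eq_reg_l with l; [|lra]. rewrite Rmult_0_r, <- Hcu. ring. }
  assert (Ekap : kap = - (b * l' * sg)) by (unfold kap, sg; rewrite Hc1, Hc2; ring).
  assert (Ekap2 : kap * kap = r * r).
  { rewrite Hcr2. transitivity ((e1 * e1 + e2 * e2) * ((c1 - p1) * (c1 - p1) + (c2 - p2) * (c2 - p2))
      - (e1 * (c1 - p1) + e2 * (c2 - p2)) * (e1 * (c1 - p1) + e2 * (c2 - p2))); [unfold kap; ring|].
    rewrite Hdot, Ee; ring. }
  assert (Hbl : 0 < b * l') by nra.
  assert (Hkr : kap = - r).
  { assert (0 <= b * l' * sg) by (apply Rmult_le_pos; lra).
    assert (E0 : (kap - r) * (kap + r) = 0) by lra.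
    apply Rmult_integral in E0. destruct E0; lra. }
  assert (Hsg : 0 < sg).
  { destruct Hsg0 as [|E0]; [assumption|]. rewrite <- E0 in Ekap. lra. }
  assert (Ec1 : c1 = p1 + r * e2).
  { transitivity (p1 + ((e1 * e1 + e2 * e2) * (c1 - p1))); [rewrite Ee; ring|].
    replace r with (- kap) by lra.
    replace ((e1 * e1 + e2 * e2) * (c1 - p1)) with
      (e1 * (e1 * (c1 - p1) + e2 * (c2 - p2)) - e2 * kap) by (unfold kap; ring).
    rewrite Hdot; ring. }
  assert (Ec2 : c2 = p2 - r * e1).
  { transitivity (p2 + ((e1 * e1 + e2 * e2) * (c2 - p2))); [rewrite Ee; ring|].
    replace r with (- kap) by lra.
    replace ((e1 * e1 + e2 * e2) * (c2 - p2)) with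
      (e2 * (e1 * (c1 - p1) + e2 * (c2 - p2)) + e1 * kap) by (unfold kap; ring).
    rewrite Hdot; ring. }
  (* Tangency to the second ray. The absolute value opens with a plus sign because the centre is
     inside the angle. *)
  assert (El : l * sg = r * (1 + q)).
  { assert (E1 : l' * f1 * (c2 - (p2 - l * e2)) - l' * f2 * (c1 - (p1 - l * e1)) = l' * (a * l * sg))
      by (rewrite Hc1, Hc2; unfold sg; ring).
    assert (E2 : l' * f1 * (c2 - (p2 - l * e2)) - l' * f2 * (c1 - (p1 - l * e1)) = l' * (l * sg - r * q))
      by (rewrite Ec1, Ec2; unfold sg, q; ring).
    assert (Hpos : 0 < l' * (a * l * sg)) by (repeat apply Rmult_lt_0_compat; lra).
    rewrite Rabs_right in Hcw by lra. rewrite E2 in Hcw.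
    assert (l * sg - r * q = r) by (apply Rmult_eq_reg_l with l'; lra). lra. }
  clear kap Ekap Ekap2 Hkr Hdot Hc1 Hc2 Hcw Hcu Hcr2 Hbl.
  assert (Hcs : Rabs (f - r * k) = r).
  { assert (E1 : n * g1 * (c2 - s2) - n * g2 * (c1 - s1) = n * (f - r * k))
      by (rewrite Ec1, Ec2; unfold f, k; ring).
    rewrite E1, Rabs_mult, (Rabs_right n) in Hs by lra.
    apply Rmult_eq_reg_l with n; lra. }
  assert (Eg1 : g1 = k * e1 - j * e2).
  { transitivity ((e1 * e1 + e2 * e2) * g1); [rewrite Ee; ring|unfold k, j; ring]. }
  assert (Eg2 : g2 = k * e2 + j * e1).
  { transitivity ((e1 * e1 + e2 * e2) * g2); [rewrite Ee; ring|unfold k, j; ring]. }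
  assert (Ef1 : f1 = q * e1 + sg * e2).
  { transitivity ((e1 * e1 + e2 * e2) * f1); [rewrite Ee; ring|unfold q, sg; ring]. }
  assert (Ef2 : f2 = q * e2 - sg * e1).
  { transitivity ((e1 * e1 + e2 * e2) * f2); [rewrite Ee; ring|unfold q, sg; ring]. }
  (* An inner common tangent of the curve and the circle passes through P. *)
  assert (Ef : f = r * (1 + k)).
  { unfold Rabs in Hcs; destruct (Rcase_abs (f - r * k)) as [Hneg|Hneg]; [exfalso|lra].
    assert (Hk1 : k <= 1) by (clear - Ek; nra).
    assert (Hrk : 0 <= r * (1 - k)) by (apply Rmult_le_pos; lra).
    assert (Ef0 : f = 0) by lra.
    assert (Ek1 : k = 1) by (clear - Hcs Hr Ef0; nra).
    assert (Ej0 : j = 0) by (clear - Ek Ek1; nra).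
    assert (Hge1 : g1 = e1) by (rewrite Eg1, Ek1, Ej0; ring).
    assert (Hge2 : g2 = e2) by (rewrite Eg2, Ek1, Ej0; ring).
    unfold f in Ef0. rewrite Hge1, Hge2 in Ef0.
    destruct Hd1 as [H|H]; apply H; [rewrite Hge1, Hge2; ring|].
    replace (l * e1 * (s2 - (p2 - l * e2)) - l * e2 * (s1 - (p1 - l * e1)))
      with (- l * (e1 * (p2 - s2) - e2 * (p1 - s1))) by ring.
    rewrite Ef0; ring. }
  assert (Efm : f = (beta - 1) * l * j).
  { assert (E1 : n * (- f + (beta - 1) * l * j) = 0).
    { rewrite HB1, HB2 in HBs. transitivity (- (n * g1 * (p2 - l * e2 + beta * (l * e2) - s2) -
            n * g2 * (p1 - l * e1 + beta * (l * e1) - s1))); [unfold f, j; ring|]. rewrite HBs; ring. }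
    apply Rmult_integral in E1. destruct E1; lra. }
  assert (HNl : N <= l).
  { pose proof (dot_sqr_le e1 e2 (p1 - o1) (p2 - o2) Ee) as H.
    assert (Hp : - C <= e1 * (p1 - o1) + e2 * (p2 - o2) <= C) by (apply abs_le_of_sqr; lra).
    assert (HD : D * D = ((p1 - o1) * (p1 - o1) + (p2 - o2) * (p2 - o2))
       - 2 * l * (e1 * (p1 - o1) + e2 * (p2 - o2)) + l * l * (e1 * e1 + e2 * e2)) by (rewrite HAO; ring).
    rewrite Ee in HD.
    set (w := e1 * (p1 - o1) + e2 * (p2 - o2)) in *.
    assert (0 <= l * (w + C)) by (apply Rmult_le_pos; lra).
    assert (HD2 : D * D <= (C + l) * (C + l)) by lra.
    apply abs_le_of_sqr in HD2; lra. }
  assert (BPM : (p1 - (p1 - l * e1 - l' * f1)) * (p1 - (p1 - l * e1 - l' * f1))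
      + (p2 - (p2 - l * e2 - l' * f2)) * (p2 - (p2 - l * e2 - l' * f2)) <= 2 * C * (2 * C)).
  { set (u1 := p1 - l * e1 - l' * f1) in *. set (u2 := p2 - l * e2 - l' * f2) in *.
    pose proof (Rle_0_sqr ((p1 - o1) + (u1 - o1))). pose proof (Rle_0_sqr ((p2 - o2) + (u2 - o2))).
    unfold Rsqr in *. lra. }
  assert (BPS : (p1 - s1) * (p1 - s1) + (p2 - s2) * (p2 - s2) <= 2 * C * (2 * C)).
  { pose proof (Rle_0_sqr ((p1 - o1) + (s1 - o1))). pose proof (Rle_0_sqr ((p2 - o2) + (s2 - o2))).
    unfold Rsqr in *. lra. }
  (* Law of cosines in the triangle [A], [x_+], [x_-]: with [q > 0] the side opposite to [A] would
     exceed [l > 2 * C], although both tangency points are within [C] of [O]. *)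
  assert (Hq0 : q <= 0).
  { assert (E1 : (p1 - (p1 - l * e1 - l' * f1)) * (p1 - (p1 - l * e1 - l' * f1))
      + (p2 - (p2 - l * e2 - l' * f2)) * (p2 - (p2 - l * e2 - l' * f2))
      = l * l * (e1 * e1 + e2 * e2) + l' * l' * (f1 * f1 + f2 * f2) + 2 * (l * l') * q) by (unfold q; ring).
    rewrite E1, Ee, Ee' in BPM. apply Rnot_lt_le; intros Hq0.
    assert (0 < l * l' * q) by (repeat apply Rmult_lt_0_compat; lra).
    assert (0 <= l' * l') by apply Rle_0_sqr.
    assert (2 * C * (2 * C) < l * l) by (apply Rmult_le_0_lt_compat; lra). lra. }
  assert (HlsC : l * sg <= 2 * C).
  { pose proof (cross_sqr_le f1 f2 _ _ Ee' : _ <= (p1 - (p1 - l * e1 - l' * f1)) * (p1 - (p1 - l * e1 - l' * f1))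
      + (p2 - (p2 - l * e2 - l' * f2)) * (p2 - (p2 - l * e2 - l' * f2))) as H.
    replace (f1 * (p2 - (p2 - l * e2 - l' * f2)) - f2 * (p1 - (p1 - l * e1 - l' * f1))) with (l * sg) in H
      by (unfold sg; ring).
    apply abs_le_of_sqr; lra. }
  assert (HfC : f <= 2 * C).
  { pose proof (cross_sqr_le g1 g2 (p1 - s1) (p2 - s2) Eg) as H. fold f in H.
    apply abs_le_of_sqr; lra. }
  (* [f] is the support at [s], minus [k] times the support at [tp], minus a term in [j]. For
     [k <= 0] the first two parts add up to at least [h]. *)
  assert (Hlow : k <= 0 -> h - Rabs j * C <= f).
  { intros Hk.
    assert (E1 : f = (g1 * (o2 - s2) - g2 * (o1 - s1)) - k * (e1 * (o2 - p2) - e2 * (o1 - p1))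
       - j * (e1 * (p1 - o1) + e2 * (p2 - o2))) by (unfold f; rewrite Eg1, Eg2; ring).
    pose proof (dot_sqr_le e1 e2 (p1 - o1) (p2 - o2) Ee) as H.
    assert (Hp : - C <= e1 * (p1 - o1) + e2 * (p2 - o2) <= C) by (apply abs_le_of_sqr; lra).
    set (w := e1 * (p1 - o1) + e2 * (p2 - o2)) in *.
    assert (j * w <= Rabs j * C).
    { apply Rle_trans with (Rabs (j * w)); [apply Rle_abs|]. rewrite Rabs_mult.
      apply Rmult_le_compat_l; [apply Rabs_pos|]. apply Rabs_le; lra. }
    assert (0 <= - k * (e1 * (o2 - p2) - e2 * (o1 - p1))) by (apply Rmult_le_pos; lra).
    lra. }
  destruct (front_distance_bound h C l r sg q f k j ((beta - 1) * l)) as [Hj Hfin]; auto; try lra.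
  { apply Rle_trans with (1 := HN2). apply Rmult_le_compat_l; [apply pow2_ge_0|]. change (N ^ 2 <= l ^ 2); apply pow_incr; lra. }
  (* If [j < 0], the third tangent crosses the line behind [x_+]. The convexity inequalities at
     [x_-] and at [s] are then those of [back_tangent_unique], which identifies the third tangent
     with the excluded line [A x_-]. *)
  assert (Hjpos : 0 < j).
  { apply Rnot_le_lt; intros Hj'. assert (Hjneg : 0 < - j) by lra. clear Hfin Hj Hj'.
    set (ls := - ((beta - 1) * l)) in *.
    assert (Els : ls * (- j) = r * (1 + k)) by (unfold ls; lra).
    set (ls' := g1 * (B1 - s1) + g2 * (B2 - s2)).
    assert (Hg0 : g1 * (B2 - s2) - g2 * (B1 - s1) = 0) by (apply Rmult_eq_reg_l with n; lra).
    assert (Es1 : s1 = p1 - ls * e1 - ls' * g1).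
    { assert (B1 - s1 = ls' * g1).
      { transitivity ((g1 * g1 + g2 * g2) * (B1 - s1)); [rewrite Eg; ring|].
        transitivity (ls' * g1 - g2 * (g1 * (B2 - s2) - g2 * (B1 - s1))); [unfold ls'; ring|].
        rewrite Hg0; ring. }
      unfold ls. lra. }
    assert (Es2 : s2 = p2 - ls * e2 - ls' * g2).
    { assert (B2 - s2 = ls' * g2).
      { transitivity ((g1 * g1 + g2 * g2) * (B2 - s2)); [rewrite Eg; ring|].
        transitivity (ls' * g2 + g1 * (g1 * (B2 - s2) - g2 * (B1 - s1))); [unfold ls'; ring|].
        rewrite Hg0; ring. }
      unfold ls. lra. }
    assert (Hls' : 0 <= ls').
    { apply Rmult_le_reg_l with (- j); [exact Hjneg|]. rewrite Rmult_0_r.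
      replace (- j * ls') with (e1 * (s2 - p2) - e2 * (s1 - p1)) by (rewrite Es1, Es2; unfold j; ring). exact F2. }
    clearbody ls ls'.
    destruct (back_tangent_unique l l' ls ls' r sg q (- j) k) as (Eqk & Esj & Ell); auto; try lra.
    - replace (sg * k - q * - j) with (f1 * g2 - f2 * g1)
        by (rewrite Ef1, Ef2, Eg1, Eg2; transitivity ((q * j + sg * k) * (e1 * e1 + e2 * e2)); [ring|rewrite Ee; ring]).
      rewrite Es1, Es2 in F3. unfold sg. lra.
    - replace (sg * k - q * - j) with (f1 * g2 - f2 * g1)
        by (rewrite Ef1, Ef2, Eg1, Eg2; transitivity ((q * j + sg * k) * (e1 * e1 + e2 * e2)); [ring|rewrite Ee; ring]).
      rewrite Es1, Es2 in F5. unfold j. lra.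
    - assert (g1 = f1) by (rewrite Eg1, Ef1, Eqk, Esj; ring).
      assert (g2 = f2) by (rewrite Eg2, Ef2, Eqk, Esj; ring).
      destruct Hd2 as [H1|H1]; apply H1; [rewrite H, H0; ring|].
      rewrite Es1, Es2, H, H0, Ell. ring. }
  destruct (Hfin Hjpos) as [Hm Hml].
  repeat split; auto.
  rewrite HB1, HB2. f_equal; ring.
Qed.

(** * Existence of the image of a far point *)

(** Along the tangent, [A] sits at [rad * cos (phi t - psi)] up to an error of at most [C]. Tangency
    gives [rad * Rabs (sin (phi t - psi)) <= C], so with [rad > 2 * C] the cosine term exceeds [C]
    in absolute value and decides the sign. *)
Lemma tangency_sign (x y phi : R -> R) (O A : pt) (h C rad psi t : R) :
  convex_frame x y phi O h C -> vsub A O = vscale rad (dir psi) -> 2 * C < rad ->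
  cross (dir (phi t)) (vsub A (curve x y t)) = 0 ->
  exists lam, vsub A (curve x y t) = vscale lam (dir (phi t)) /\
    (0 < cos (phi t - psi) -> 0 < lam) /\ (cos (phi t - psi) < 0 -> lam < 0).
Proof.
  intros Hf HA Hrad H0.
  exists (dot (dir (phi t)) (vsub A (curve x y t))).
  pose proof (frame_h_pos _ _ _ _ _ _ Hf) as Hh. pose proof (frame_h_le_C _ _ _ _ _ _ Hf) as HhC.
  pose proof (frame_bounded_sqr _ _ _ _ _ _ t Hf) as B.
  pose proof (dir_unit (phi t)) as Ee. pose proof (dir_unit (phi t - psi)) as E.
  pose proof (f_equal fst HA) as HA1; pose proof (f_equal snd HA) as HA2.
  pose proof (cos_minus (phi t) psi) as Ecos. pose proof (sin_minus (phi t) psi) as Esin.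
  destruct A as [A1 A2], O as [o1 o2].
  unfold cross, dot, vsub, vscale, dir, curve in *; simpl in *.
  set (e1 := cos (phi t)) in *. set (e2 := sin (phi t)) in *.
  set (k := cos (phi t - psi)) in *. set (s := sin (phi t - psi)) in *.
  set (c0 := cos psi) in *. set (s0 := sin psi) in *.
  set (p1 := x t) in *. set (p2 := y t) in *.
  clearbody e1 e2 k s c0 s0 p1 p2.
  pose proof (cross_sqr_le e1 e2 (p1 - o1) (p2 - o2) Ee) as Hc.
  pose proof (dot_sqr_le e1 e2 (p1 - o1) (p2 - o2) Ee) as Hd.
  assert (Hs : rad * s = - (e1 * (p2 - o2) - e2 * (p1 - o1))).
  { rewrite Esin. replace A2 with (o2 + rad * s0) in H0 by lra. replace A1 with (o1 + rad * c0) in H0 by lra. lra. }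
  assert (Hk : e1 * (A1 - p1) + e2 * (A2 - p2) = rad * k - (e1 * (p1 - o1) + e2 * (p2 - o2))).
  { rewrite Ecos. replace A2 with (o2 + rad * s0) by lra. replace A1 with (o1 + rad * c0) by lra. ring. }
  split; [|].
  - f_equal.
    + transitivity ((e1 * e1 + e2 * e2) * (A1 - p1)); [rewrite Ee; ring|].
      transitivity ((e1 * (A1 - p1) + e2 * (A2 - p2)) * e1 - e2 * (e1 * (A2 - p2) - e2 * (A1 - p1))); [ring|].
      rewrite H0; ring.
    + transitivity ((e1 * e1 + e2 * e2) * (A2 - p2)); [rewrite Ee; ring|].
      transitivity ((e1 * (A1 - p1) + e2 * (A2 - p2)) * e2 + e1 * (e1 * (A2 - p2) - e2 * (A1 - p1))); [ring|].
      rewrite H0; ring.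
  - rewrite Hk. set (w := e1 * (p1 - o1) + e2 * (p2 - o2)) in *.
    assert (Hw : - C <= w <= C) by (apply abs_le_of_sqr; lra).
    assert (Hs2 : rad * s * (rad * s) <= C * C) by (rewrite Hs; lra).
    assert (Hk2 : C * C < rad * k * (rad * k)).
    { assert (rad * s * (rad * s) + rad * k * (rad * k) = rad * rad)
        by (transitivity (rad * rad * (k * k + s * s)); [ring|rewrite E; ring]).
      assert (2 * C * (2 * C) < rad * rad) by (apply Rmult_le_0_lt_compat; lra).
      assert (0 < C * C) by (apply Rmult_lt_0_compat; lra). lra. }
    split; intros Hsg.
    + assert (0 < rad * k) by (apply Rmult_lt_0_compat; lra).
      assert (C < rad * k) by (clear - Hk2 H HhC Hh; nra). lra.
    + assert (0 < rad * - k) by (apply Rmult_lt_0_compat; lra).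
      assert (C < - (rad * k)) by (clear - Hk2 H HhC Hh; nra). lra.
Qed.

(** The height of [A] above the tangent of angle [phi t] is [rad * sin (psi - phi t)] plus a support
    value in [[h, C]]. It is positive at [psi], negative at [psi + PI / 2] and positive at
    [psi + PI]. The zero in the first quarter turn is [x_-], the one in the second is [x_+]. *)
Lemma far_exterior_tangencies (x y phi : R -> R) (O A : pt) (h C : R) :
  convex_frame x y phi O h C -> 2 * C < vnorm (vsub A O) ->
  exterior x y A /\
  exists tp tm l l', 0 < l /\ 0 < l' /\
    vsub (curve x y tp) A = vscale l (dir (phi tp)) /\
    vsub A (curve x y tm) = vscale l' (dir (phi tm)) /\
    0 < phi tp - phi tm < PI.
Proof.
  intros Hf Hfar. pose proof PI_RGT_0 as Hpi.
  destruct (polar_form (vsub A O)) as [psi Hpsi].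
  set (rad := vnorm (vsub A O)) in *.
  set (f := fun t => cross (dir (phi t)) (vsub A (curve x y t))).
  pose proof (frame_h_pos _ _ _ _ _ _ Hf) as Hh. pose proof (frame_h_le_C _ _ _ _ _ _ Hf) as HhC.
  pose proof (frame_derive_x _ _ _ _ _ _ Hf) as dx. pose proof (frame_derive_y _ _ _ _ _ _ Hf) as dy.
  pose proof (frame_derive_phi _ _ _ _ _ _ Hf) as dphi.
  assert (cf : forall t, continuous f t).
  { intros t; apply ex_derive_continuous_R. unfold f, cross, vsub, dir, curve; simpl.
    auto_derive; repeat split; auto. }
  assert (Hfv : forall t, f t = rad * sin (psi - phi t) + cross (dir (phi t)) (vsub O (curve x y t))).
  { intros t. rewrite <- cross_dir. pose proof (f_equal fst Hpsi) as H1. pose proof (f_equal snd Hpsi) as H2.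
    unfold f, cross, vsub, vscale in *; simpl in *.
    replace (fst A) with (fst O + rad * cos psi) by lra.
    replace (snd A) with (snd O + rad * sin psi) by lra. ring. }
  assert (HH : forall t, h <= cross (dir (phi t)) (vsub O (curve x y t)) <= C).
  { intros t; split; [apply (frame_support _ _ _ _ _ _ Hf)|].
    pose proof (frame_bounded_sqr _ _ _ _ _ _ t Hf) as B.
    pose proof (cross_sqr_le (cos (phi t)) (sin (phi t)) (fst O - x t) (snd O - y t) (dir_unit _)) as Hc.
    unfold cross, vsub, curve, dir; simpl. apply abs_le_of_sqr; lra. }
  destruct (frame_surjective _ _ _ _ _ _ Hf psi) as [t1 E1].
  destruct (frame_surjective _ _ _ _ _ _ Hf (psi + PI / 2)) as [t2 E2].
  destruct (frame_surjective _ _ _ _ _ _ Hf (psi + PI)) as [t3 E3].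
  assert (Hrefl : forall s t, phi s < phi t -> s < t).
  { intros s t H. destruct (Rtotal_order s t) as [E|[E|E]]; [exact E|subst; lra|].
    apply (frame_increasing _ _ _ _ _ _ Hf) in E; lra. }
  pose proof (HH t1) as B1. pose proof (HH t2) as B2. pose proof (HH t3) as B3.
  assert (f1 : 0 < f t1).
  { rewrite Hfv, E1. replace (psi - psi) with 0 by ring. rewrite sin_0. rewrite E1 in B1. lra. }
  assert (f2 : f t2 < 0).
  { rewrite Hfv, E2. replace (psi - (psi + PI / 2)) with (- (PI / 2)) by ring.
    rewrite sin_neg, sin_PI2. rewrite E2 in B2. lra. }
  assert (f3 : 0 < f t3).
  { rewrite Hfv, E3. replace (psi - (psi + PI)) with (- PI) by ring.
    rewrite sin_neg, sin_PI. rewrite E3 in B3. lra. }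
  split.
  { intros HK. specialize (HK t2). rewrite (frame_tangent _ _ _ _ _ _ Hf t2) in HK.
    pose proof (frame_speed _ _ _ _ _ _ Hf t2) as n2. set (n := vnorm (tangent x y t2)) in *.
    assert (E : cross (vscale n (dir (phi t2))) (vsub A (curve x y t2)) = n * f t2)
      by (unfold f, cross, vscale; simpl; ring).
    rewrite E in HK. nra. }
  destruct (IVT_sign f t1 t2) as [tm [Htm Hm0]]; auto; [apply Hrefl; lra|nra|].
  destruct (IVT_sign f t2 t3) as [tp [Htp Hp0]]; auto; [apply Hrefl; lra|nra|].
  destruct Htm as [Hm1 Hm2]; apply (frame_increasing _ _ _ _ _ _ Hf) in Hm1, Hm2.
  destruct Htp as [Hp1 Hp2]; apply (frame_increasing _ _ _ _ _ _ Hf) in Hp1, Hp2.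
  destruct (tangency_sign x y phi O A h C rad psi tm) as (l' & Hl' & Hl'pos & _); auto.
  destruct (tangency_sign x y phi O A h C rad psi tp) as (l & Hl & _ & Hlneg); auto.
  exists tp, tm, (- l), l'. repeat split.
  - assert (l < 0); [|lra]. apply Hlneg. apply cos_lt_0; lra.
  - apply Hl'pos. apply cos_gt_0; lra.
  - pose proof (f_equal fst Hl) as H1; pose proof (f_equal snd Hl) as H2.
    unfold vsub, vscale in *; simpl in *. f_equal; lra.
  - exact Hl'.
  - lra.
  - lra.
Qed.

(** The third tangent comes from the intermediate value theorem: [g] compares the distance from
    [x_+] to the tangent at [t] with the distance [r * (1 + cos (phi t - phi tp))] that tangency to
    the circle requires. At [tp] it is [- 2 * r]; at the antiparallel tangent it is the width of the
    oval. *)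
Lemma far_is_F_exists (x y phi : R -> R) (O A : pt) (h C : R) :
  convex_frame x y phi O h C -> 2 * C < vnorm (vsub A O) ->
  exists B, is_F x y A B.
Proof.
  intros Hf Hfar. pose proof PI_RGT_0 as Hpi.
  destruct (far_exterior_tangencies x y phi O A h C Hf Hfar) as (Hext & tp & tm & l & l' & Hl & Hl' & Hu & Hw & Hang).
  pose proof (frame_h_pos _ _ _ _ _ _ Hf) as Hh.
  pose proof (frame_derive_x _ _ _ _ _ _ Hf) as dx. pose proof (frame_derive_y _ _ _ _ _ _ Hf) as dy.
  pose proof (frame_derive_phi _ _ _ _ _ _ Hf) as dphi.
  set (sg := sin (phi tp - phi tm)). set (q := cos (phi tp - phi tm)).
  assert (Hsg : 0 < sg) by (apply sin_gt_0; lra).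
  assert (Eq : q * q + sg * sg = 1) by apply dir_unit.
  assert (Hq : 0 < 1 + q) by nra.
  set (r := l * sg / (1 + q)).
  assert (Hr : 0 < r) by (apply Rdiv_lt_0_compat; nra).
  assert (Er : l * sg = r * (1 + q)) by (unfold r; field; lra).
  clearbody r.
  set (P := curve x y tp) in *. set (M := curve x y tm) in *.
  set (g := fun t => cross (dir (phi t)) (vsub P (curve x y t)) - r * (1 + cos (phi t - phi tp))).
  assert (cg : forall t, continuous g t).
  { intros t; apply ex_derive_continuous_R. unfold g, cross, vsub, dir, curve; simpl.
    auto_derive; repeat split; auto. }
  destruct (frame_surjective _ _ _ _ _ _ Hf (phi tp + PI)) as [t4 E4].
  assert (Hord : tp < t4).
  { destruct (Rtotal_order tp t4) as [E|[E|E]]; [exact E|subst; lra|].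
    apply (frame_increasing _ _ _ _ _ _ Hf) in E; lra. }
  assert (g0 : g tp < 0).
  { unfold g. replace (phi tp - phi tp) with 0 by ring. rewrite cos_0.
    replace (vsub P (curve x y tp)) with (0, 0) by (unfold P, vsub; f_equal; ring).
    unfold cross; simpl. nra. }
  assert (g4 : 0 < g t4).
  { unfold g. replace (phi t4 - phi tp) with PI by lra. rewrite cos_PI.
    pose proof (frame_support _ _ _ _ _ _ Hf tp) as H1. pose proof (frame_support _ _ _ _ _ _ Hf t4) as H2.
    rewrite E4 in *. unfold dir in *. rewrite neg_cos, neg_sin in *.
    fold P in H1. unfold cross, vsub in *; simpl in *. lra. }
  destruct (IVT_sign g tp t4) as [s [Hs Hgs]]; auto; [nra|].
  destruct Hs as [Hs1 Hs2]; apply (frame_increasing _ _ _ _ _ _ Hf) in Hs1, Hs2.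
  pose proof (frame_speed _ _ _ _ _ _ Hf tp) as np. pose proof (frame_speed _ _ _ _ _ _ Hf tm) as nm.
  pose proof (frame_speed _ _ _ _ _ _ Hf s) as ns.
  set (nrp := vnorm (tangent x y tp)) in *. set (nrm := vnorm (tangent x y tm)) in *.
  set (n := vnorm (tangent x y s)) in *.
  set (S := curve x y s).
  set (j := sin (phi s - phi tp)). set (k := cos (phi s - phi tp)).
  assert (Hj : 0 < j) by (apply sin_gt_0; lra).
  set (beta := cross (dir (phi s)) (vsub A S) / (l * j)).
  set (c := (fst P + r * sin (phi tp), snd P - r * cos (phi tp))).
  exists (vadd A (vscale beta (vsub P A))).
  split; [exact Hext|].
  exists tp, tm, (l / nrp), (l' / nrm).
  split; [now apply Rdiv_lt_0_compat|]. split; [now apply Rdiv_lt_0_compat|].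
  split.
  { fold P. rewrite Hu, (frame_tangent _ _ _ _ _ _ Hf tp). fold nrp. unfold vscale; simpl. f_equal; field; lra. }
  split.
  { fold M. rewrite Hw, (frame_tangent _ _ _ _ _ _ Hf tm). fold nrm. unfold vscale; simpl. f_equal; field; lra. }
  pose proof (frame_support _ _ _ _ _ _ Hf tm) as HsuppM.
  cbv zeta. fold P M in HsuppM |- *. clearbody P M.
  assert (EA1 : fst A = fst P - l * cos (phi tp))
    by (assert (fst P - fst A = l * cos (phi tp)) by exact (f_equal fst Hu); lra).
  assert (EA2 : snd A = snd P - l * sin (phi tp))
    by (assert (snd P - snd A = l * sin (phi tp)) by exact (f_equal snd Hu); lra).
  assert (EM1 : fst M = fst A - l' * cos (phi tm))
    by (assert (fst A - fst M = l' * cos (phi tm)) by exact (f_equal fst Hw); lra).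
  assert (EM2 : snd M = snd A - l' * sin (phi tm))
    by (assert (snd A - snd M = l' * sin (phi tm)) by exact (f_equal snd Hw); lra).
  rewrite Hu, Hw.
  pose proof (dir_unit (phi tp)) as Ee.
  pose proof (sin_minus (phi tp) (phi tm)) as Esg. fold sg in Esg.
  pose proof (cos_minus (phi tp) (phi tm)) as Eqq. fold q in Eqq.
  pose proof (sin_minus (phi s) (phi tp)) as Ej. fold j in Ej.
  pose proof (cos_minus (phi s) (phi tp)) as Ekk. fold k in Ekk.
  assert (Etan : tangent x y s = vscale n (dir (phi s))) by exact (frame_tangent _ _ _ _ _ _ Hf s).
  assert (Ef1 : cos (phi tm) = q * cos (phi tp) + sg * sin (phi tp)).
  { transitivity ((cos (phi tp) * cos (phi tp) + sin (phi tp) * sin (phi tp)) * cos (phi tm)); [rewrite Ee; ring|].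
    rewrite Esg, Eqq; ring. }
  assert (Ef2 : sin (phi tm) = q * sin (phi tp) - sg * cos (phi tp)).
  { transitivity ((cos (phi tp) * cos (phi tp) + sin (phi tp) * sin (phi tp)) * sin (phi tm)); [rewrite Ee; ring|].
    rewrite Esg, Eqq; ring. }
  exists c, r. split; [exact Hr|]. split.
  (* Found by splitting the centre along the direction at [x_+] and its right normal: the normal
     part gives the second coefficient, then the tangential part the first. *)
  { exists (/ (1 + q)), (r / (l' * sg)).
    split; [now apply Rinv_0_lt_compat|]. split; [apply Rdiv_lt_0_compat; [lra|nra]|].
    assert (El : l = r * (1 + q) / sg) by (rewrite <- Er; field; lra).
    unfold c, vadd, vscale, dir; simpl. rewrite EA1, EA2, Ef1, Ef2, El. f_equal; field; lra. }
  split.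
  { unfold c, dot, vsub, vscale; simpl. ring. }
  split.
  { unfold c, vnorm, dot, vsub; simpl.
    match goal with |- sqrt ?e = _ => replace e with (Rsqr r) end; [apply sqrt_Rsqr; lra|].
    unfold Rsqr. transitivity (r * r * (cos (phi tp) * cos (phi tp) + sin (phi tp) * sin (phi tp))); [rewrite Ee; ring|ring]. }
  split.
  { rewrite vnorm_vscale_dir by lra.
    assert (E : cross (vscale l' (dir (phi tm))) (vsub c A) = r * l').
    { unfold cross, vscale, vsub, c; simpl. rewrite EA1, EA2.
      transitivity (l' * (l * sg - r * q)); [rewrite Esg, Eqq; ring|]. rewrite Er; ring. }
    rewrite E. apply Rabs_right. nra. }
  exists s. fold S. rewrite Etan.
  assert (Ecs : cross (dir (phi s)) (vsub c S) = r).
  { unfold g in Hgs. fold S k in Hgs. unfold cross, vsub, c in *; simpl in *.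
    assert (E : cos (phi s) * (snd P - r * cos (phi tp) - y s) - sin (phi s) * (fst P + r * sin (phi tp) - x s)
      = cos (phi s) * (snd P - y s) - sin (phi s) * (fst P - x s) - r * k) by (rewrite Ekk; ring).
    rewrite E. lra. }
  split.
  { rewrite vnorm_vscale_dir by lra.
    assert (E : cross (vscale n (dir (phi s))) (vsub c S) = n * r)
      by (rewrite <- Ecs; unfold cross, vscale; simpl; ring).
    rewrite E, Rabs_right by nra. ring. }
  assert (Ecr : cross (vscale n (dir (phi s))) (vscale l (dir (phi tp))) = - (n * l * j)).
  { rewrite Ej. unfold cross, vscale, dir; simpl; ring. }
  split.
  { left. rewrite Ecr. assert (0 < n * l * j) by (repeat apply Rmult_lt_0_compat; lra). lra. }
  split.
  { set (X := cross (dir (phi s)) (dir (phi tm))).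
    destruct (Req_dec X 0) as [HX|HX].
    - (* The tangent at [s] is antiparallel to the one at [tm]: the two lines are a width apart. *)
      right.
      (* [phi s - phi tm] lies in [(0, 2 * PI)], where the sine vanishes only at [PI]. *)
      assert (Hd : cos (phi s - phi tm) = -1).
      { assert (E : sin (phi tm - phi s) = 0) by (rewrite <- cross_dir; exact HX).
        replace (phi s - phi tm) with (PI + (phi s - phi tm - PI)) by ring.
        assert (phi s - phi tm = PI).
        { destruct (Rtotal_order (phi s - phi tm) PI) as [H|[H|H]]; [|exact H|].
          - assert (0 < sin (phi s - phi tm)) by (apply sin_gt_0; lra).
            replace (phi tm - phi s) with (- (phi s - phi tm)) in E by ring. rewrite sin_neg in E. lra.
          - assert (sin (phi s - phi tm) < 0) by (apply sin_lt_0; lra).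
            replace (phi tm - phi s) with (- (phi s - phi tm)) in E by ring. rewrite sin_neg in E. lra. }
        rewrite H. replace (PI + (PI - PI)) with PI by ring. apply cos_PI. }
      assert (Hs0 : sin (phi s - phi tm) = 0).
      { pose proof (dir_unit (phi s - phi tm)). rewrite Hd in H. nra. }
      assert (Es1 : cos (phi s) = - cos (phi tm)).
      { replace (phi s) with (phi tm + (phi s - phi tm)) by ring. rewrite cos_plus, Hd, Hs0. ring. }
      assert (Es2 : sin (phi s) = - sin (phi tm)).
      { replace (phi s) with (phi tm + (phi s - phi tm)) by ring. rewrite sin_plus, Hd, Hs0. ring. }
      pose proof (frame_support _ _ _ _ _ _ Hf s) as H2.
      fold S in H2.
      assert (E : cross (vscale l' (dir (phi tm))) (vsub S A) =
        l' * (cross (dir (phi s)) (vsub O S) + cross (dir (phi tm)) (vsub O M))).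
      { unfold cross, vscale, vsub, dir; simpl. rewrite Es1, Es2, EM1, EM2. ring. }
      rewrite E. assert (0 < l' * (cross (dir (phi s)) (vsub O S) + cross (dir (phi tm)) (vsub O M)))
        by (apply Rmult_lt_0_compat; lra). lra.
    - left. assert (E : cross (vscale n (dir (phi s))) (vscale l' (dir (phi tm))) = n * l' * X)
        by (unfold X, cross, vscale; simpl; ring).
      rewrite E. repeat apply Rmult_integral_contrapositive_currified; lra. }
  exists beta. split; [reflexivity|].
  transitivity (n * (cross (dir (phi s)) (vsub A S) - beta * (l * j))).
  - rewrite Ej. unfold cross, vscale, vsub, vadd, dir; simpl. ring.
  - unfold beta. field. split; lra.
Qed.

(** * Far orbits *)

(* The direction of [b] is that of [- a] turned clockwise by an angle of tangent in [(0, eps]]. *)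
Definition almost_opposite (eps : R) (a b : pt) : Prop :=
  0 < cross a b /\ cross a b <= eps * - dot a b.

(** Seen from [O], the cross product of the two positions is [l + m] times a support value, at most
    [(l + m) * C], while minus their dot product is [l * m] up to terms of order [l + m]. The
    quotient is thus small when [l] and [m] are both large. *)
Lemma far_F_almost_opposite (x y phi : R -> R) (O : pt) (h C eps V : R) :
  convex_frame x y phi O h C -> 0 < eps ->
  exists N, forall A, N <= vnorm (vsub A O) ->
    V <= vnorm (vsub (F x y A) O) /\
    almost_opposite eps (vsub A O) (vsub (F x y A) O).
Proof.
  intros Hf Heps.
  pose proof (frame_h_pos _ _ _ _ _ _ Hf) as Hh. pose proof (frame_h_le_C _ _ _ _ _ _ Hf) as HhC.
  (* [W] is the bound wanted for both [l] and [m]: [Rabs V + C] keeps the image at distance [V] from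
     [O], and the rest absorbs the lower-order terms of the dot product. *)
  set (W := Rabs V + C + 2 * (C / eps + 2 * C)).
  assert (HV : V <= Rabs V) by apply Rle_abs. assert (HV0 : 0 <= Rabs V) by apply Rabs_pos.
  assert (Hce : 0 < C / eps) by (apply Rdiv_lt_0_compat; lra).
  assert (HW : 0 < W) by (unfold W; lra).
  assert (Hch : 0 < 16 * C / h) by (apply Rdiv_lt_0_compat; lra).
  assert (Hch2 : 0 < 6 * C ^ 2 / h) by (apply Rdiv_lt_0_compat; nra).
  (* The first term gives [m >= W] through [h * l ^ 2 <= 16 * C * m ^ 2]; the second gives
     [32 * C ^ 4 <= h ^ 2 * N ^ 2], as [6 ^ 2 > 32]; the last two give [N > 2 * C]. *)
  set (N := W * (16 * C / h + 1) + 6 * C ^ 2 / h + 2 * C + 1).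
  assert (HWN : 0 < W * (16 * C / h + 1)) by (apply Rmult_lt_0_compat; lra).
  exists (C + N). intros A HA.
  assert (HFA : is_F x y A (F x y A)).
  { apply (epsilon_spec (inhabits A) (fun B => is_F x y A B)).
    apply (far_is_F_exists x y phi O A h C Hf). unfold N in HA. lra. }
  destruct (is_F_far_estimate x y phi O A (F x y A) h C N) as (t & l & m & HNl & Hm & Hlm & EA & EB); auto.
  { unfold N; lra. }
  { assert (Hb : 6 * C ^ 2 / h * h = 6 * C ^ 2) by (field; lra).
    assert (HhN : 6 * C ^ 2 <= h * N).
    { assert (6 * C ^ 2 / h <= N) by (unfold N; lra).
      assert (6 * C ^ 2 / h * h <= N * h) by (apply Rmult_le_compat_r; lra). lra. }
    assert (H0 : 0 <= 6 * C ^ 2) by nra.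
    assert (6 * C ^ 2 * (6 * C ^ 2) <= h * N * (h * N)) by (apply Rmult_le_compat; lra).
    assert (0 <= C ^ 2 * C ^ 2) by nra. lra. }
  assert (HWl : W * (16 * C / h + 1) <= l) by (unfold N in HNl; lra).
  assert (HWl1 : W <= l) by (apply Rle_trans with (2 := HWl); nra).
  assert (HWm : W <= m).
  { assert (H1 : W * (16 * C / h + 1) * (W * (16 * C / h + 1)) <= l ^ 2).
    { replace (l ^ 2) with (l * l) by ring. apply Rmult_le_compat; lra. }
    assert (H2 : W * W * (16 * C / h) <= W * (16 * C / h + 1) * (W * (16 * C / h + 1))).
    { replace (W * (16 * C / h + 1) * (W * (16 * C / h + 1)))
        with (W * W * ((16 * C / h + 1) * (16 * C / h + 1))) by ring.
      apply Rmult_le_compat_l; nra. }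
    assert (H3 : h * (W * W * (16 * C / h)) <= h * l ^ 2) by (apply Rmult_le_compat_l; lra).
    replace (h * (W * W * (16 * C / h))) with (16 * C * (W * W)) in H3 by (field; lra).
    assert (H4 : W * W <= m ^ 2) by (apply Rmult_le_reg_l with (16 * C); lra).
    nra. }
  pose proof (frame_bounded_sqr _ _ _ _ _ _ t Hf) as B.
  pose proof (frame_support _ _ _ _ _ _ Hf t) as Hs.
  pose proof (dir_unit (phi t)) as Ee.
  pose proof (vnorm_sqr (vsub (F x y A) O)) as HBn. pose proof (vnorm_pos (vsub (F x y A) O)) as HBp.
  set (D := vnorm (vsub (F x y A) O)) in *. clearbody D.
  rewrite EB in HBn |- *. rewrite EA. clear EA EB HFA HA.
  unfold almost_opposite. destruct O as [o1 o2].
  unfold cross, dot, vsub, vadd, vscale, curve, dir in *; simpl in *.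
  set (e1 := cos (phi t)) in *. set (e2 := sin (phi t)) in *.
  set (p1 := x t) in *. set (p2 := y t) in *. clearbody e1 e2 p1 p2.
  pose proof (cross_sqr_le e1 e2 (p1 - o1) (p2 - o2) Ee) as Hc.
  pose proof (dot_sqr_le e1 e2 (p1 - o1) (p2 - o2) Ee) as Hd.
  set (H := e1 * (o2 - p2) - e2 * (o1 - p1)) in *.
  set (w := e1 * (p1 - o1) + e2 * (p2 - o2)) in *.
  set (Q := (p1 - o1) * (p1 - o1) + (p2 - o2) * (p2 - o2)) in *.
  assert (Hw : - C <= w <= C) by (apply abs_le_of_sqr; lra).
  assert (HH : H <= C).
  { apply abs_le_of_sqr; [lra|]. unfold H. lra. }
  assert (Ecr : (p1 - l * e1 - o1) * (p2 + m * e2 - o2) - (p2 - l * e2 - o2) * (p1 + m * e1 - o1) = (l + m) * H)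
    by (unfold H; ring).
  assert (Edot : (p1 - l * e1 - o1) * (p1 + m * e1 - o1) + (p2 - l * e2 - o2) * (p2 + m * e2 - o2)
     = Q + (m - l) * w - l * m).
  { transitivity (Q + (m - l) * w - l * m * (e1 * e1 + e2 * e2)); [unfold Q, w; ring|rewrite Ee; ring]. }
  assert (EDD : D * D = Q + 2 * m * w + m * m).
  { rewrite HBn. transitivity (Q + 2 * m * w + m * m * (e1 * e1 + e2 * e2)); [unfold Q, w; ring|rewrite Ee; ring]. }
  rewrite Ecr, Edot. clear Ecr Edot HBn.
  assert (HwQ : w * w <= Q) by exact Hd.
  clearbody H w Q. clear Hc Hd Ee.
  assert (HDm : m - C <= D).
  { assert (Hsq : (m + w) * (m + w) <= D * D) by lra.
    apply abs_le_of_sqr in Hsq; lra. }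
  split; [unfold W in HWm; lra|].
  split; [apply Rmult_lt_0_compat; lra|].
  assert (Hlm1 : W / 2 * (l + m) <= l * m).
  { assert (0 <= (l - W) * m) by (apply Rmult_le_pos; lra).
    assert (0 <= (m - W) * l) by (apply Rmult_le_pos; lra). lra. }
  assert (Hmw : (m - l) * w <= (l + m) * C).
  { assert (0 <= m * (C - w)) by (apply Rmult_le_pos; lra).
    assert (0 <= l * (C + w)) by (apply Rmult_le_pos; lra). lra. }
  assert (HCC : C * C <= (l + m) * C) by (apply Rmult_le_compat_r; [lra|unfold W in *; lra]).
  assert (Hge : (l + m) * (C / eps) <= - (Q + (m - l) * w - l * m)).
  { assert (0 <= (l + m) * (W / 2 - 2 * C - C / eps)) by (apply Rmult_le_pos; unfold W; lra). lra. }
  apply Rle_trans with (eps * ((l + m) * (C / eps))).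
  - replace (eps * ((l + m) * (C / eps))) with ((l + m) * C) by (field; lra).
    apply Rmult_le_compat_l; lra.
  - apply Rmult_le_compat_l; lra.
Qed.

(** Thresholds are chosen backwards: the start must be so far that its image passes the threshold
    for the remaining [n] steps. *)
Lemma far_orbit_almost_opposite (x y phi : R -> R) (O : pt) (h C eps : R) :
  convex_frame x y phi O h C -> 0 < eps ->
  forall n, exists N, forall A, N <= vnorm (vsub A O) ->
    forall i, (i < n)%nat ->
      almost_opposite eps (vsub (Nat.iter i (F x y) A) O) (vsub (Nat.iter (S i) (F x y) A) O).
Proof.
  intros Hf Heps n. induction n as [|n [N IH]].
  - exists 0. intros; lia.
  - destruct (far_F_almost_opposite x y phi O h C eps N Hf Heps) as [N' HN'].
    exists N'. intros A HA i Hi. destruct (HN' A HA) as [H1 H2].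
    destruct i as [|i]; [exact H2|].
    rewrite !(Nat.iter_succ_r (S i)), (Nat.iter_succ_r i). apply (IH _ H1). lia.
Qed.

(* Along the sequence [(-1) ^ i z_i], the directions turn clockwise, by a positive
   total angle that stays below [PI / 2]; so [z_n] is not on the line spanned by [z_0]. *)
Lemma almost_opposite_aperiodic (z : nat -> pt) (eps : R) (n : nat) :
  (0 < n)%nat -> 0 < eps -> 2 ^ n * (2 * eps) <= 1 ->
  (forall i, (i < n)%nat -> almost_opposite eps (z i) (z (S i))) ->
  z n <> z O.
Proof.
  intros Hn Heps Hsmall Hz Hper.
  assert (Hz0 : 0 < dot (z O) (z O)).
  { destruct (Hz O Hn) as [H _]. unfold cross, dot in *.
    destruct (Req_dec (fst (z O)) 0) as [E|E]; [|nra].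
    destruct (Req_dec (snd (z O)) 0) as [E'|E']; [rewrite E, E' in H; lra|nra]. }
  (* The tangent of the total angle is at most [(2 ^ i - 1) * (2 * eps)]. This solves
     [T (i + 1) = 2 * (T i + eps)], [T 0 = 0], where the factor 2 bounds the inverse of the
     denominator in the addition formula for tangents. *)
  assert (Hind : forall i, (i <= n)%nat ->
    0 < (-1) ^ i * dot (z O) (z i) /\
    0 <= - ((-1) ^ i * cross (z O) (z i)) /\
    ((0 < i)%nat -> 0 < - ((-1) ^ i * cross (z O) (z i))) /\
    - ((-1) ^ i * cross (z O) (z i)) <= (2 ^ i - 1) * (2 * eps) * ((-1) ^ i * dot (z O) (z i))).
  { induction i as [|i IH]; intros Hi.
    - simpl. assert (E : cross (z O) (z O) = 0) by (unfold cross; ring). rewrite E.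
      repeat split; try lra. lia.
    - destruct IH as (HD & HE & _ & HT); [lia|].
      destruct (Hz i Hi) as [Hcr Hdot].
      assert (HNi : 0 < dot (z i) (z i)).
      { unfold cross, dot in Hcr |- *.
        destruct (Req_dec (fst (z i)) 0) as [E|E]; [|nra].
        destruct (Req_dec (snd (z i)) 0) as [E'|E']; [rewrite E, E' in Hcr; lra|nra]. }
      set (N := dot (z i) (z i)) in *.
      (* [z (S i)] is [- p] times [z i] plus [kap] times its counterclockwise quarter turn. *)
      set (p := - dot (z i) (z (S i)) / N). set (kap := cross (z i) (z (S i)) / N).
      assert (Hkap : 0 < kap) by (apply Rdiv_lt_0_compat; lra).
      assert (Hkp : kap <= eps * p).
      { unfold kap, p, Rdiv. rewrite <- Rmult_assoc. apply Rmult_le_compat_r; [|lra].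
        left; now apply Rinv_0_lt_compat. }
      assert (Hp : 0 < p) by nra.
      assert (Ed : dot (z O) (z (S i)) = - p * dot (z O) (z i) - kap * cross (z O) (z i)).
      { unfold p, kap. apply Rmult_eq_reg_l with N; [|lra]. field_simplify; [|lra].
        unfold N, dot, cross. ring. }
      assert (Ec : cross (z O) (z (S i)) = - p * cross (z O) (z i) + kap * dot (z O) (z i)).
      { unfold p, kap. apply Rmult_eq_reg_l with N; [|lra]. field_simplify; [|lra].
        unfold N, dot, cross. ring. }
      set (d := (-1) ^ i * dot (z O) (z i)) in *.
      set (e := - ((-1) ^ i * cross (z O) (z i))) in *.
      assert (Ed' : (-1) ^ S i * dot (z O) (z (S i)) = p * d - kap * e)
        by (rewrite Ed; unfold d, e; simpl; ring).
      assert (Ec' : - ((-1) ^ S i * cross (z O) (z (S i))) = p * e + kap * d)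
        by (rewrite Ec; unfold d, e; simpl; ring).
      rewrite Ed', Ec'.
      assert (H2i : 1 <= 2 ^ i) by (apply pow_R1_Rle; lra).
      assert (H2n : 2 * 2 ^ i <= 2 ^ n).
      { change (2 ^ S i <= 2 ^ n). apply Rle_pow; [lra|lia]. }
      assert (Hbnd : 2 * 2 ^ i * (2 * eps) <= 1).
      { apply Rle_trans with (2 := Hsmall). apply Rmult_le_compat_r; lra. }
      set (a := 2 ^ i) in *.
      assert (Hed : e <= d).
      { apply Rle_trans with (1 := HT). replace d with (1 * d) at 2 by ring.
        apply Rmult_le_compat_r; [lra|]. lra. }
      assert (Hke : kap * e <= / 2 * (p * d)).
      { apply Rle_trans with (eps * p * d); [apply Rmult_le_compat; lra|].
        rewrite Rmult_assoc. apply Rmult_le_compat_r; [nra|].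
        assert (2 * 1 * (2 * eps) <= 2 * a * (2 * eps)) by (apply Rmult_le_compat_r; lra). lra. }
      assert (Hpd : 0 < p * d) by nra.
      assert (Hkd : 0 < kap * d) by nra. assert (Hpe : 0 <= p * e) by nra.
      repeat split; try lra.
      apply Rle_trans with ((2 ^ S i - 1) * (2 * eps) * (/ 2 * (p * d))).
      + assert (p * e <= p * ((a - 1) * (2 * eps) * d)) by (apply Rmult_le_compat_l; lra).
        assert (kap * d <= eps * p * d) by (apply Rmult_le_compat_r; lra).
        change (2 ^ S i) with (2 * a). lra.
      + apply Rmult_le_compat_l; [|lra]. apply Rmult_le_pos; [|lra]. change (2 ^ S i) with (2 * a). lra. }
  destruct (Hind n (Nat.le_refl n)) as (_ & _ & H & _). specialize (H Hn).
  rewrite Hper in H. replace (cross (z O) (z O)) with 0 in H by (unfold cross; ring). lra.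
Qed.

Theorem theorem4p15 (x y : R -> R) (L : R) (O : pt) :
  is_oval x y L ->
  in_interior_K x y O ->
  forall k : nat, (0 < k)%nat ->
  exists rho : R,
    forall z : pt,
      exterior x y z ->
      Nat.iter k (F x y) z = z ->
      vnorm (vsub z O) <= rho.
Proof.
  intros Hoval Hint k Hk.
  destruct (oval_convex_frame x y L O Hoval Hint) as (phi & h & C & Hf).
  (* With this value the smallness condition of [almost_opposite_aperiodic] holds with equality. *)
  set (eps := / (2 ^ k * 2)).
  assert (H2k : 0 < 2 ^ k) by (apply pow_lt; lra).
  assert (Heps : 0 < eps) by (apply Rinv_0_lt_compat; lra).
  destruct (far_orbit_almost_opposite x y phi O h C eps Hf Heps k) as [N HN].
  exists N. intros z _ Hper.
  apply Rnot_lt_le; intros Hfar.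
  apply (almost_opposite_aperiodic (fun i => vsub (Nat.iter i (F x y) z) O) eps k Hk Heps).
  - unfold eps. right. field. lra.
  - apply HN. lra.
  - simpl. now rewrite Hper.
Qed.
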